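(* Let $A$ be a Noetherian local ring with maximal ideal $\mathfrak{m}$ and $d = \dim A \geq 2$. Assume that $A$ is a homomorphic image of a Gorenstein local ring and that $\dim A/\mathfrak{p} = d$ for all $\mathfrak{p} \in \operatorname{Ass} A$. Then $A$ contains a system $a_1, a_2, \dots, a_d$ of parameters such that for all integers $n_i \geq 1$ $(1 \leq i \leq d)$ the equality $I^2 = QI$ holds true, where $$Q = (a_1^{n_1}, a_2^{n_2}, \dots, a_d^{n_d}) \quad\text{and}\quad I = Q : \mathfrak{m}.$$
   Context: For ideals $\mathfrak{a},\mathfrak{b}$ of a ring $A$, $\mathfrak{a}:\mathfrak{b} = \{x \in A \mid x\mathfrak{b} \subseteq \mathfrak{a}\}$. *)

(* Defs.v *)
From HB Require Import structures.
From mathcomp Require Import all_boot all_order all_algebra.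
From mathcomp Require Import boolp classical_sets.

Set Implicit Arguments.
Unset Strict Implicit.
Unset Printing Implicit Defensive.

Import GRing.Theory.
Local Open Scope classical_set_scope.
Local Open Scope ring_scope.

(* [idealr R] and [prime_idealr R] are the types of proper, resp. prime, ideals
   of R.  Ideals that may be the unit ideal (sums, products, colons) are plain
   sets; a proper ideal J is turned into one by [set` J]. *)

Section IdealOperations.
Variable R : comNzRingType.
Implicit Types a b : set R.

Definition ideal_gen (k : nat) (g : 'I_k -> R) : set R :=
  [set x | exists c : 'I_k -> R, x = \sum_(i < k) c i * g i].

Definition ideal_mul a b : set R :=
  [set x | exists k (u v : 'I_k -> R),
     (forall i, a (u i) /\ b (v i)) /\ x = \sum_(i < k) u i * v i].

Definition ideal_colon a b : set R :=
  [set x | forall y, b y -> a (x * y)].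

Definition radical a : set R := [set x | exists n : nat, a (x ^+ n)].

End IdealOperations.

(* The unit ideal, not covered by [idealr R], is generated by 1. *)
Definition noetherian (R : comNzRingType) : Prop :=
  forall J : idealr R, exists k (g : 'I_k -> R), [set` J] = ideal_gen g.

Definition maximal_ideal (R : comNzRingType) (m : idealr R) : Prop :=
  forall J : idealr R, {subset m <= J} -> J =i m.

Definition local_ring (R : comNzRingType) (m : idealr R) : Prop :=
  maximal_ideal m /\ forall m' : idealr R, maximal_ideal m' -> m' =i m.

Definition prime_chain (R : comNzRingType) (k : nat)
    (p : 'I_k.+1 -> prime_idealr R) : Prop :=
  forall i j : 'I_k.+1, (i < j)%N -> [set` p i] `<` [set` p j].

Definition krull_dim (R : comNzRingType) (d : nat) : Prop :=
  (exists p : 'I_d.+1 -> prime_idealr R, prime_chain p) /\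
  (forall k (p : 'I_k.+1 -> prime_idealr R), prime_chain p -> (k <= d)%N).

Definition associated_prime (R : comNzRingType) (p : prime_idealr R) : Prop :=
  exists x : R, forall y : R, (y \in p) = (y * x == 0).

Definition system_of_parameters (R : comNzRingType) (m : idealr R) (d : nat)
    (a : 'I_d -> R) : Prop :=
  krull_dim R d /\ radical (ideal_gen a) = [set` m].

Definition injective_module (R : comNzRingType) (E : lmodType R) : Prop :=
  forall (M N : lmodType R) (i : {linear M -> N}) (f : {linear M -> E}),
    injective i -> exists g : {linear N -> E}, forall x, g (i x) = f x.

(* An injective resolution 0 -> M -> E 0 -> E 1 -> ... with E i = 0 for n < i. *)
Definition inj_dim_le (R : comNzRingType) (M : lmodType R) (n : nat) : Prop :=
  exists (E : nat -> lmodType R) (eta : {linear M -> E 0%N})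
         (d : forall i, {linear E i -> E i.+1}),
  [/\ forall i, injective_module (E i),
      injective eta,
      range eta = [set y | d 0%N y = 0],
      forall i, range (d i) = [set y | d i.+1 y = 0] &
      forall i, (n < i)%N -> forall y : E i, y = 0].

Definition gorenstein_local (R : comNzRingType) : Prop :=
  [/\ noetherian R, exists m : idealr R, local_ring m &
      exists n, inj_dim_le (R^o : lmodType R) n].

Definition image_of_gorenstein_local (R : comNzRingType) : Prop :=
  exists (S : comNzRingType) (f : {rmorphism S -> R}),
    gorenstein_local S /\ range f = setT.

(* Main.v *)
Require Import Defs.
From HB Require Import structures.
From mathcomp Require Import all_boot all_order all_algebra.
From mathcomp Require Import boolp classical_sets.
From mathcomp Require Import ring zify.
Import GRing.Theory.
Local Open Scope classical_set_scope.
Local Open Scope ring_scope.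

Set Implicit Arguments.
Unset Strict Implicit.
Unset Printing Implicit Defensive.

(** The ring S maps onto A with kernel J.  Finite injective dimension makes S
Cohen-Macaulay, in the form: primes associated to an ideal generated by a
regular sequence have no proper inclusions from other primes above that ideal.
Take a maximal S-regular sequence z in J.  For a prime Q associated to
X_l = (z, a_1, ..., a_l) the module S/Q embeds into S/X_l, whose higher Koszul
homology on powers of a_(l+1), ..., a_d vanishes; hence the Koszul homology of
S/Q is controlled by that of finitely many S/P.  Choosing a_(l+1) inside all
the P not associated to X_l and outside the associated primes of X_l, one gets
parameters such that a power of a_i annihilates, for all exponents at once, the
first Koszul homology of A on powers of elements of {a_i, ..., a_d}.

Replacing the a_i by powers, put Q_i = (b_j : j > i) with b_j = a_j^(n_j).
Then a_i kills (Q_i : a_i^oo) / Q_i and the coefficients modulo Q_i of every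
relation between the b_j, j > i.  This gives a decomposition
(Q_(i-1) : m) = (Q_i : m) + a_i^(n_i - 1) K with m K inside
(Q_i : a_i) + (a_i), and (Q_i : m)^2 = Q_i (Q_i : m) follows by descending
induction on i. *)

(** * Ideals, associated primes and regular sequences *)

(** The obstacle is uniformity: one annihilator must serve for all exponents n_i. Powers of a
    regular sequence are again regular, so S/X_l has no higher Koszul homology whatever the
    exponents, and the resulting bound counts only filtration lengths and the number of elements.
    The ring S is what supplies the modules S/X_l.

    The condition on dim A/p shows that m is not associated, since A/m has dimension 0; hence (0 :
    m) = 0, which starts the descending induction. The condition d >= 2 prevents m from being
    principal and so excludes discrete valuation rings, where I^2 = QI fails: there Q = (t^n) and I
    = (t^(n-1)).

    The parameters are finally cubed. In the square of a_i^(n_i - 1) K one factor a_i is spent on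
    moving an element of (Q_i : a_i) into Q_i, and the other 2 n_i - 3 factors must still contain
    a_i^(n_i), so n_i >= 3 is required. *)

Section Ideals.
Variable R : comNzRingType.
Implicit Types (I J P Q : set R) (x y g : R).

Definition is_ideal I :=
  [/\ I 0, forall x y, I x -> I y -> I (x + y) & forall c x, I x -> I (c * x)].

Definition is_prime P :=
  [/\ is_ideal P, ~ P 1 & forall x y, P (x * y) -> P x \/ P y].

Definition addgen I g : set R := [set x | exists c y, I y /\ x = y + c * g].

Definition addgens I s : set R := foldr (fun g J => addgen J g) I s.

Definition colon1 I g : set R := [set x | I (x * g)].

Lemma ideal_zero I : is_ideal I -> I 0. Proof. by case. Qed.
Lemma ideal_add I x y : is_ideal I -> I x -> I y -> I (x + y).
Proof. by case=> _ h _; apply: h. Qed.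
Lemma ideal_mull I x y : is_ideal I -> I y -> I (x * y).
Proof. by case=> _ _ h; apply: h. Qed.
Lemma ideal_mulr I x y : is_ideal I -> I x -> I (x * y).
Proof. by move=> iI Ix; rewrite mulrC; apply: ideal_mull. Qed.
Lemma ideal_opp I x : is_ideal I -> I x -> I (- x).
Proof. by move=> iI Ix; rewrite -mulN1r; apply: ideal_mull. Qed.
Lemma ideal_sub I x y : is_ideal I -> I x -> I y -> I (x - y).
Proof. by move=> iI Ix Iy; apply: ideal_add => //; apply: ideal_opp. Qed.
Lemma ideal_unit I x : is_ideal I -> I 1 -> I x.
Proof. by move=> iI I1; rewrite -[x]mulr1; apply: ideal_mull. Qed.
Lemma ideal_sum I (T : Type) (r : seq T) (p : pred T) (F : T -> R) :
  is_ideal I -> (forall i, p i -> I (F i)) -> I (\sum_(i <- r | p i) F i).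
Proof.
move=> iI h; elim/big_rec: _ => [|i x pi Ix]; first exact: ideal_zero.
by apply: ideal_add => //; apply: h.
Qed.
Lemma ideal_addKl I x y : is_ideal I -> I x -> I (x + y) -> I y.
Proof. by move=> iI Ix Ixy; rewrite -[y](addKr x) addrC; apply: ideal_sub. Qed.

Lemma zero_ideal : is_ideal [set 0].
Proof. by split=> [//|_ _ -> ->|c _ ->]; rewrite ?addr0 ?mulr0. Qed.

Lemma addgen_ideal I g : is_ideal I -> is_ideal (addgen I g).
Proof.
move=> iI; split.
- by exists 0, 0; split; [exact: ideal_zero | ring].
- move=> _ _ [c [y [Iy ->]]] [c' [y' [Iy' ->]]].
  by exists (c + c'), (y + y'); split; [exact: ideal_add | ring].
- move=> a _ [c [y [Iy ->]]].
  by exists (a * c), (a * y); split; [exact: ideal_mull | ring].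
Qed.

Lemma colon1_ideal I g : is_ideal I -> is_ideal (colon1 I g).
Proof.
move=> iI; split=> [|x y|c x]; rewrite /colon1 /=.
- by rewrite mul0r; apply: ideal_zero.
- by rewrite mulrDl; apply: ideal_add.
- by rewrite -mulrA; apply: ideal_mull.
Qed.

Lemma sub_colon1 I g : is_ideal I -> I `<=` colon1 I g.
Proof. by move=> iI x Ix; apply: ideal_mulr. Qed.

Lemma sub_addgen I g : I `<=` addgen I g.
Proof. by move=> x Ix; exists 0, x; split=> //; ring. Qed.

Lemma mem_addgen I g : is_ideal I -> addgen I g g.
Proof. by move=> iI; exists 1, 0; split; [exact: ideal_zero | ring]. Qed.

Lemma addgen_min I J g : is_ideal J -> I `<=` J -> J g -> addgen I g `<=` J.
Proof. by move=> iJ IJ Jg _ [c [y [Iy ->]]]; apply: ideal_add => //; [apply: IJ|apply: ideal_mull]. Qed.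

Lemma addgens_ideal I s : is_ideal I -> is_ideal (addgens I s).
Proof. by move=> iI; elim: s => //= g s; apply: addgen_ideal. Qed.

Lemma sub_addgens I s : I `<=` addgens I s.
Proof. by elim: s => //= g s h x /h; apply: sub_addgen. Qed.

Lemma mem_addgens I s x : is_ideal I -> x \in s -> addgens I s x.
Proof.
move=> iI; elim: s => //= g s h; rewrite inE => /orP[/eqP->|/h]; last exact: sub_addgen.
by apply: mem_addgen; apply: addgens_ideal.
Qed.

Lemma addgens_min I J s : is_ideal J -> I `<=` J -> (forall x, x \in s -> J x) ->
  addgens I s `<=` J.
Proof.
move=> iJ IJ; elim: s => //= g s h sJ; apply: addgen_min => //.
  by apply: h => x xs; apply: sJ; rewrite inE xs orbT.
by apply: sJ; rewrite mem_head.
Qed.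

Lemma addgens_cat I s t : addgens I (s ++ t) = addgens (addgens I t) s.
Proof. by rewrite /addgens foldr_cat. Qed.

Lemma addgens_eqmem I s t : is_ideal I -> s =i t -> addgens I s = addgens I t.
Proof.
move=> iI st; rewrite eqEsubset; split; apply: addgens_min;
  do ?[exact: addgens_ideal | exact: sub_addgens] => x.
  by rewrite st; apply: mem_addgens.
by rewrite -st; apply: mem_addgens.
Qed.

Lemma ideal_gen_ideal k (g : 'I_k -> R) : is_ideal (ideal_gen g).
Proof.
split.
- by exists (fun=> 0); rewrite big1 // => i _; rewrite mul0r.
- move=> _ _ [c ->] [c' ->]; exists (fun i => c i + c' i).
  by rewrite -big_split; apply: eq_bigr => i _; rewrite mulrDl.
- move=> a _ [c ->]; exists (fun i => a * c i).
  by rewrite mulr_sumr; apply: eq_bigr => i _; rewrite mulrA.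
Qed.

Lemma mem_ideal_gen k (g : 'I_k -> R) i : ideal_gen g (g i).
Proof.
exists (fun j => (j == i)%:R); rewrite (bigD1 i) //= eqxx mul1r big1 ?addr0 //.
by move=> j /negPf->; rewrite mul0r.
Qed.

Lemma ideal_gen_min k (g : 'I_k -> R) J : is_ideal J -> (forall i, J (g i)) ->
  ideal_gen g `<=` J.
Proof. by move=> iJ h _ [c ->]; apply: ideal_sum => // i _; apply: ideal_mull. Qed.

Lemma ideal_gen_addgens k (g : 'I_k -> R) : ideal_gen g = addgens [set 0] (codom g).
Proof.
rewrite eqEsubset; split.
  apply: ideal_gen_min => [|i]; first exact/addgens_ideal/zero_ideal.
  by apply: mem_addgens; [exact: zero_ideal | exact: codom_f].
apply: addgens_min => [|_ ->|x]; first exact: ideal_gen_ideal.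
  by apply: ideal_zero; apply: ideal_gen_ideal.
by move=> /codomP[i ->]; apply: mem_ideal_gen.
Qed.

Lemma primeM P x y : is_prime P -> ~ P x -> ~ P y -> ~ P (x * y).
Proof. by case=> _ _ h Px Py /h[]. Qed.

Lemma primeX P x n : is_prime P -> P (x ^+ n) -> P x.
Proof.
case=> _ P1 h; elim: n => [|n IH]; first by rewrite expr0 => /P1.
by rewrite exprS => /h[].
Qed.

Definition noeth := forall I, is_ideal I -> exists k (g : 'I_k -> R), I = ideal_gen g.

Hypothesis nR : noeth.

Lemma noeth_ind (p : set R -> Prop) :
  (forall I, is_ideal I -> (forall J, is_ideal J -> I `<` J -> p J) -> p I) ->
  forall I, is_ideal I -> p I.
Proof.
move=> step I0 iI0; apply: contrapT => npI0.
pose T := {I | is_ideal I /\ ~ p I}.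
have /choice[f fP] (t : T) : exists t' : T, sval t `<` sval t'.
  case: t => I [iI npI] /=; apply: contrapT => h; apply: npI; apply: step => // J iJ IJ.
  apply: contrapT => npJ; apply: h.
  by exists (exist _ J (conj iJ npJ)).
pose u n := sval (iter n f (exist _ I0 (conj iI0 npI0))).
have iu n : is_ideal (u n) by rewrite /u; case: (iter n _ _) => J [].
have uS n : u n `<` u n.+1 by rewrite /u iterS; apply: fP.
have umono n k : u n `<=` u (k + n)%N.
  by elim: k => // k IH; apply: subset_trans IH _; case: (uS (k + n)%N).
have umonoL n k : (n <= k)%N -> u n `<=` u k by move=> /subnK <-.
pose U := [set x | exists n, u n x].
have iU : is_ideal U.
  split.
  - by exists 0%N; apply: ideal_zero.
  - move=> x y [n ux] [k uy]; exists (maxn n k).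
    apply: ideal_add => //; first exact: umonoL (leq_maxl _ _) _ ux.
    exact: umonoL (leq_maxr _ _) _ uy.
  - by move=> c x [n ux]; exists n; apply: ideal_mull.
have [k [g Ug]] := nR iU.
have /choice[N NP] i : exists n, u n (g i) by have : U (g i) by rewrite Ug; exact: mem_ideal_gen.
pose M := \max_i N i.
have UM : U `<=` u M.
  rewrite Ug; apply: ideal_gen_min => // i; apply: umonoL (NP i).
  exact: leq_bigmax.
by case: (uS M) => _; apply; apply: subset_trans UM; move=> x ux; exists M.+1.
Qed.

(** Induction on (I : x): if it is not prime, some u v x lies in I with u x and v x outside, and (I
    : x u) is strictly larger because it contains v. *)
Lemma ass_exists I x : is_ideal I -> ~ I x ->
  exists w, is_prime (colon1 I (x * w)).
Proof.
move=> iI; have [J JE] : exists J, J = colon1 I x by exists (colon1 I x).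
have iJ : is_ideal J by rewrite JE; exact: colon1_ideal.
move: J iJ x JE; apply: noeth_ind => J iJ IH x JE nIx.
have [pr|npr] := pselect (is_prime (colon1 I x)); first by exists 1; rewrite mulr1.
have [u [v [Iuv nu nv]]] : exists u v, [/\ I (u * v * x), ~ I (u * x) & ~ I (v * x)].
  apply: contrapT => h; apply: npr; split; first exact: colon1_ideal.
    by rewrite /colon1 /= mul1r.
  move=> u v; rewrite /colon1 /= => Iuv; apply: contrapT => /not_orP[nu nv].
  by apply: h; exists u, v.
have [|||w pw] := IH (colon1 I (x * u)) _ _ (x * u) erefl.
- exact: colon1_ideal.
- rewrite JE; split=> [y Iy|h].
    by rewrite /colon1 /= mulrA; apply: ideal_mulr.
  have /h : colon1 I (x * u) v by rewrite /colon1 /= [v * _](_ : _ = u * v * x) //; ring.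
  by [].
- by rewrite mulrC.
by exists (u * w); rewrite mulrA.
Qed.

(* R/I has a filtration of length r whose factors are R/P with P in L. *)
Inductive filt (L : set R -> Prop) : nat -> set R -> Prop :=
| filt0 I : I 1 -> filt L 0 I
| filtS r I g : L (colon1 I g) -> filt L r (addgen I g) -> filt L r.+1 I.

Lemma filt_mono (L L' : set R -> Prop) r I :
  (forall P, L P -> L' P) -> filt L r I -> filt L' r I.
Proof. by move=> LL; elim=> [J J1|k J g Lc _ IH]; [apply: filt0|apply: filtS (LL _ Lc) IH]. Qed.

Lemma filt_exists I : is_ideal I -> exists (L : seq (set R)) r,
  filt (fun P => P \in L) r I /\ forall P, P \in L -> is_prime P /\ I `<=` P.
Proof.
move: I; apply: noeth_ind => I iI IH.
have [I1|nI1] := pselect (I 1); first by exists [::], 0%N; split=> //; apply: filt0.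
have [w pw] := ass_exists iI nI1; rewrite mul1r in pw.
have [||L [r [fL hL]]] := IH (addgen I w).
- exact: addgen_ideal.
- split; first exact: sub_addgen.
  move=> /(_ _ (mem_addgen w iI)) Iw; case: pw => _ + _; apply.
  by rewrite /colon1 /= mul1r.
exists (colon1 I w :: L), r.+1; split.
  apply: (filtS (g := w)); first exact: mem_head.
  by apply: filt_mono fL => P PL; rewrite inE PL orbT.
move=> P; rewrite inE => /orP[/eqP->|/hL[pP IP]]; first by split=> //; apply: sub_colon1.
by split=> //; apply: subset_trans IP; apply: sub_addgen.
Qed.

(** Every nonzero element of R/P has annihilator P. So either a nonzero multiple of x lies in the
    copy of R/(I : g) generated by g, or R x meets that copy trivially and x keeps its annihilator
    in the quotient. *)
Lemma ass_in_filt (L : set R -> Prop) r I : (forall P, L P -> is_prime P) ->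
  filt L r I -> is_ideal I -> forall x, is_prime (colon1 I x) -> L (colon1 I x).
Proof.
move=> LP; elim=> {r I} [I I1 iI x [_ + _]|r I g Lg _ IH iI x pQ].
  by case; exact: (@ideal_unit I (1 * x)).
have [iQ Q1 QM] := pQ; have [_ _ PM] := LP _ Lg.
have [[v [Av nIv]]|h] := pselect (exists v, addgen I g (v * x) /\ ~ I (v * x)).
  suff -> : colon1 I x = colon1 I g by [].
  have [c [y [Iy vE]]] := Av.
  have colE u : I (u * (v * x)) <-> I (u * (c * g)).
    rewrite vE mulrDr; split; first by apply: ideal_addKl => //; apply: ideal_mull.
    by move=> h; apply: ideal_add => //; apply: ideal_mull.
  have nPc : ~ I (c * g) by rewrite -[c * g]mul1r -colE mul1r.
  rewrite eqEsubset; split=> u Iu.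
    have /colE : I (u * (v * x)) by rewrite mulrCA; apply: ideal_mull.
    by rewrite mulrA => /PM[].
  have /colE : I (u * (c * g)) by rewrite mulrCA; apply: ideal_mull.
  by rewrite mulrA => /QM[].
have -> : colon1 I x = colon1 (addgen I g) x.
  rewrite eqEsubset; split=> u; rewrite /colon1 /=; first exact: sub_addgen.
  by move=> Au; apply: contrapT => nI; apply: h; exists u.
apply: IH; first exact: addgen_ideal.
have <- // : colon1 I x = colon1 (addgen I g) x.
rewrite eqEsubset; split=> u; rewrite /colon1 /=; first exact: sub_addgen.
by move=> Au; apply: contrapT => nI; apply: h; exists u.
Qed.

Lemma avoid_in (C : seq (set R)) Q : is_prime Q ->
  (forall P, P \in C -> is_ideal P /\ ~ P `<=` Q) ->
  exists x, ~ Q x /\ forall P, P \in C -> P x.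
Proof.
move=> pQ; elim: C => [|P C IH] h; first by exists 1; split=> //; case: pQ.
have [|x [Qx xC]] := IH; first by move=> P' P'C; apply: h; rewrite inE P'C orbT.
have [iP /nonsubset[y [Py Qy]]] := h P (mem_head _ _).
exists (x * y); split; first exact: primeM.
move=> P'; rewrite inE => /orP[/eqP->|P'C]; first exact: ideal_mull.
by apply: ideal_mulr; [case: (h P'); rewrite ?inE ?P'C ?orbT|apply: xC].
Qed.

Lemma prime_avoidance I (L : seq (set R)) : is_ideal I ->
  (forall P, P \in L -> is_prime P /\ ~ I `<=` P) ->
  exists x, I x /\ forall P, P \in L -> ~ P x.
Proof.
move=> iI; elim: L => [|P L IH] h; first by exists 0; split=> //; exact: ideal_zero.
have [|x [Ix xL]] := IH; first by move=> P' P'L; apply: h; rewrite inE P'L orbT.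
have [pP IP] := h P (mem_head _ _).
have [nPx|Px] := pselect (~ P x).
  by exists x; split=> // P'; rewrite inE => /orP[/eqP->//|]; apply: xL.
have {}Px : P x by apply: contrapT.
have iP : is_ideal P by case: pP.
(* The correction [y] lies in I and in the listed primes not contained in P, but not in P. Adding it
   moves x out of P; a prime inside P cannot contain [x + y] either, and the others see no
   change. *)
pose C := I :: [seq P' <- L | ~~ `[< P' `<=` P >]].
have [|y [nPy yC]] := @avoid_in C P pP.
  move=> P'; rewrite inE => /orP[/eqP->//|]; rewrite mem_filter => /andP[/asboolPn nP P'L].
  by split=> //; case: (h P'); rewrite ?inE ?P'L ?orbT // => -[].
have Iy : I y by apply: yC; rewrite mem_head.
exists (x + y); split; first exact: ideal_add.
move=> P'; rewrite inE => /orP[/eqP->|P'L P'xy].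
  by move/(ideal_addKl iP Px).
have [P'P|nP'P] := pselect (P' `<=` P).
  by apply: nPy; apply: (ideal_addKl iP Px); apply: P'P.
have [[iP' _ _] _] : is_prime P' /\ ~ I `<=` P' by apply: h; rewrite inE P'L orbT.
apply: (xL _ P'L); apply: (ideal_addKl iP' (x := y)); last by rewrite addrC.
by apply: yC; rewrite inE mem_filter P'L andbT; apply/orP; right; apply/asboolPn.
Qed.

Lemma det_trick (E : lmodType R) (B : set E) k (M : 'M[R]_k) (z : 'I_k -> E) :
  B 0 -> (forall e f, B e -> B f -> B (e + f)) -> (forall c e, B e -> B (c *: e)) ->
  (forall t, B (\sum_u M t u *: z u)) -> forall u, B (\det M *: z u).
Proof.
move=> B0 BD BZ BM u.
have -> : \det M *: z u = \sum_t \adj M u t *: \sum_w M t w *: z w.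
  under eq_bigr => t _ do rewrite scaler_sumr.
  rewrite exchange_big /=.
  under eq_bigr => w _ do (under eq_bigr => t _ do rewrite scalerA;
    rewrite -scaler_suml).
  have aM w : \sum_t \adj M u t * M t w = \det M *+ (u == w).
    by have /matrixP/(_ u w) := mul_adj_mx M; rewrite !mxE.
  rewrite (bigD1 u) //= aM eqxx mulr1n big1 ?addr0 // => w uw.
  by rewrite aM eq_sym (negPf uw) mulr0n scale0r.
by elim/big_rec: _ => // t x _ Bx; apply: BD => //; apply: BZ.
Qed.

Lemma prod_congr I (T : Type) (r : seq T) (F G : T -> R) : is_ideal I ->
  (forall i, I (F i - G i)) -> I (\prod_(i <- r) F i - \prod_(i <- r) G i).
Proof.
move=> iI h; elim/big_rec2: _ => [|i x y _ IH]; first by rewrite subrr; apply: ideal_zero.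
have -> : F i * y - G i * x = y * (F i - G i) + G i * (y - x) by ring.
by apply: ideal_add => //; apply: ideal_mull.
Qed.

Lemma det_congr I k (M N : 'M[R]_k) : is_ideal I ->
  (forall i j, I (M i j - N i j)) -> I (\det M - \det N).
Proof.
move=> iI h; rewrite /determinant -sumrB; apply: ideal_sum => // s _.
by rewrite -mulrBr; apply: ideal_mull => //; apply: prod_congr.
Qed.

(** Nakayama at Q with denominators cleared: modulo Q the determinant of diag(s) - y c is the
    product of the [s t], hence outside Q, and Cramer's rule applies. *)
Lemma loc_nakayama (E : lmodType R) (B : set E) Q y k (z : 'I_k -> E) :
  B 0 -> (forall e f, B e -> B f -> B (e + f)) -> (forall c e, B e -> B (c *: e)) ->
  is_prime Q -> Q y ->
  (forall t, exists s (c : 'I_k -> R), ~ Q s /\ B (s *: z t - y *: \sum_u c u *: z u)) ->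
  exists s, ~ Q s /\ forall t, B (s *: z t).
Proof.
move=> B0 BD BZ pQ Qy h.
have /choice[s /choice[c scP]] := h.
pose M : 'M[R]_k := \matrix_(t, u) (s t *+ (t == u) - y * c t u).
have iQ : is_ideal Q by case: pQ.
exists (\det M); split.
  have detQ : Q (\det M - \det (diag_mx (\row_t s t))).
    apply: det_congr => // t u; rewrite !mxE -addrAC subrr add0r.
    by apply: ideal_opp => //; apply: ideal_mulr.
  move=> Qd; have : Q (\det (diag_mx (\row_t s t))).
    by rewrite -[\det _](subKr (\det M)); apply: ideal_sub.
  rewrite det_diag; elim/big_ind: _ => [||t _]; first by case: pQ.
    by move=> a b na nb; case: pQ => _ _ + => /[apply]-[].
  by rewrite mxE; case: (scP t).
apply: det_trick => // t; case: (scP t) => _.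
suff -> : \sum_u M t u *: z u = s t *: z t - y *: \sum_u c t u *: z u by [].
under eq_bigr => u _ do rewrite mxE scalerBl.
rewrite sumrB (bigD1 t) //= eqxx mulr1n big1 ?addr0.
  by rewrite scaler_sumr; congr (_ - _); apply: eq_bigr => u _; rewrite scalerA.
by move=> u; rewrite eq_sym => /negPf->; rewrite scale0r.
Qed.

(** * Nakayama's lemma and regular sequences in a local ring *)

Variable m : set R.
Hypothesis im : is_prime m.
Hypothesis um : forall x, ~ m x -> exists y, x * y = 1.

Lemma nakayama I W y : is_ideal I -> is_ideal W -> m y ->
  (forall w, W w -> exists2 w', W w' & I (w - y * w')) -> W `<=` I.
Proof.
move=> iI iW my h.
have [k [g gE]] := nR iW.
have [||t|s [ns sg]] := @loc_nakayama R^o I m y k g (ideal_zero iI) _ _ im my.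
- by move=> x z; apply: ideal_add.
- by move=> c x; apply: ideal_mull.
- have [] := h (g t); first by rewrite gE; apply: mem_ideal_gen.
  move=> w'; rewrite gE => -[c ->] hw; exists 1, c; split; first by case: im.
  by rewrite scale1r.
have [s' ss'] := um ns.
rewrite gE; apply: ideal_gen_min => // i.
by rewrite -[g i]mul1r -ss' [s * s']mulrC -mulrA; apply: ideal_mull => //; apply: sg.
Qed.

(** Sequences are read from the right, the head being the last element. The quotient may be zero;
    membership in m is imposed separately. *)
Fixpoint reg I s : Prop :=
  if s is c :: s' then reg I s' /\ forall v, addgens I s' (v * c) -> addgens I s' v
  else True.

Lemma reg_cat I s t : reg I (s ++ t) <-> reg I t /\ reg (addgens I t) s.
Proof.
elim: s => [|c s IH] /=; first by split=> // -[].
by rewrite IH addgens_cat; tauto.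
Qed.

(** With B = I + (s), an element of (B : a) lies in B + b (B : a), so Nakayama makes a regular
    modulo B; exchanging the roles of a and b in a syzygy does the rest. *)
Lemma reg_swap I a b s : is_ideal I -> m a -> m b ->
  reg I (a :: b :: s) -> reg I (b :: a :: s).
Proof.
move=> iI ma mb /= [[rs hb] ha].
set B := addgens I s in rs hb ha *; have iB : is_ideal B by apply: addgens_ideal.
have ha' v : B (v * a) -> B v.
  move: v; apply: (nakayama iB (colon1_ideal a iB) mb) => v Bv.
  have [|c [y [By vE]]] := ha v; first exact: sub_addgen.
  exists c; last by rewrite vE mulrC addrK.
  apply: hb; move: Bv; rewrite /colon1 /= vE mulrDl => /(ideal_addKl iB (ideal_mulr a iB By)).
  by rewrite mulrAC.
split; first by split=> // v; apply: ha'.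
move=> v [c [y [By vE]]].
have [|c' [y' [By' cE]]] := ha c.
  exists v, (- y); split; first exact: ideal_opp.
  by rewrite vE; ring.
have /hb Bv : B ((v - c' * a) * b).
  have -> : (v - c' * a) * b = y + y' * a.
    by rewrite mulrBl vE cE; ring.
  by apply: ideal_add => //; apply: ideal_mulr.
by exists c', (v - c' * a); split=> //; ring.
Qed.

Lemma reg_front I a s t : is_ideal I -> m a -> (forall x, x \in s -> m x) ->
  reg I (s ++ a :: t) -> reg I (a :: s ++ t).
Proof.
move=> iI ma; elim: s => // b s IH sm /= [rs hb].
have sE : addgens I (s ++ a :: t) = addgens I (a :: s ++ t).
  apply: addgens_eqmem => // x.
  by rewrite -[a :: s ++ t]cat1s -[a :: t]cat1s !mem_cat inE orbCA.
apply: (@reg_swap I b a) => //; first by apply: sm; rewrite mem_head.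
split; last by rewrite -sE.
by apply: IH => // x xs; apply: sm; rewrite inE xs orbT.
Qed.

Lemma reg_perm I s t : is_ideal I -> (forall x, x \in s -> m x) ->
  perm_eq s t -> reg I s -> reg I t.
Proof.
move=> iI; elim: t s => [|a t IH] s sm.
  by move=> /perm_nilP->.
move=> pst; have as_ : a \in s by rewrite (perm_mem pst) mem_head.
have ma := sm _ as_.
case/splitPr: as_ pst sm => s1 s2 pst sm.
have pst' : perm_eq (s1 ++ s2) t.
  by rewrite -(perm_cons a) (perm_catCA [:: a] s1 s2).
move=> /(reg_front iI ma).
case=> [x xs1|rs h].
  by apply: sm; rewrite mem_cat xs1.
split; last by rewrite -(addgens_eqmem iI (perm_mem pst')).
apply: IH pst' rs => x xs; apply: sm.
by move: xs; rewrite !mem_cat inE => /orP[->//|->]; rewrite !orbT.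
Qed.

Lemma reg_pow_head I a s n : is_ideal I -> reg I (a :: s) -> reg I (a ^+ n :: s).
Proof.
move=> iI [rs h]; split=> // v; elim: n => [|n IH]; first by rewrite expr0 mulr1.
by rewrite exprSr mulrA => /h.
Qed.

Lemma reg_fam (T : eqType) (a : T -> R) (e : T -> nat) I (L L' : seq T) :
  is_ideal I -> (forall i, i \in L -> m (a i) /\ (0 < e i)%N) -> uniq L -> uniq L' ->
  {subset L' <= L} -> reg I [seq a i | i <- L] ->
  reg I [seq a i ^+ e i | i <- L'].
Proof.
move=> iI am uL uL' LL' rL.
have idm : is_ideal m by case: im.
have pL : perm_eq L ([seq i <- L | i \notin L'] ++ L').
  apply: uniq_perm => //.
    rewrite cat_uniq filter_uniq // uL' andbT /=; apply/hasPn => i iL'.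
    by rewrite mem_filter iL'.
  move=> i; rewrite mem_cat mem_filter; case: (boolP (i \in L')) => [/LL'->|_] //=.
  by rewrite orbF.
have {rL} : reg I [seq a i | i <- L'].
  have /(reg_perm iI _)/(_ rL) : perm_eq [seq a i | i <- L]
      [seq a i | i <- [seq i <- L | i \notin L'] ++ L'] by apply: perm_map.
  rewrite map_cat => /(_ _)/reg_cat[x /mapP[i /am[? _] ->]|] //.
have {}am i : i \in L' -> m (a i) /\ (0 < e i)%N by move/LL'/am.
(* The added list collects the elements already raised to powers: each round raises the head, then
   moves it behind the untreated ones. *)
rewrite -[X in reg I X -> _]cats0 -[X in _ -> reg I X]cats0.
have : forall x, x \in ([::] : seq R) -> m x by [].
move: am [::]; elim: L' {uL' LL' pL} => // i L' IH am t mt /=.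
move=> /(reg_pow_head (e i) iI) rL.
have amS j : j \in L' -> m (a j) /\ (0 < e j)%N.
  by move=> jL; apply: am; rewrite inE jL orbT.
have mei : m (a i ^+ e i).
  have [mi /prednK <-] := am i (mem_head _ _).
  by rewrite exprS; apply: ideal_mulr.
have mm (s' : seq R) x : x \in s' -> (forall y, y \in s' -> y = a i ^+ e i \/ y \in t \/
    exists2 j, j \in L' & y = a j \/ y = a j ^+ e j) -> m x.
  move=> xs h; have [->//|[/mt//|[j /amS[mj /prednK <-]] [->//|->]]] := h _ xs.
  by rewrite exprS; apply: ideal_mulr.
have /IH : forall x, x \in a i ^+ e i :: t -> m x.
  by move=> x; rewrite inE => /orP[/eqP->//|/mt].
move=> /(_ amS) IH'.
have {rL}/IH' : reg I ([seq a j | j <- L'] ++ a i ^+ e i :: t).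
  apply: reg_perm rL => //; last first.
    by rewrite -(cat1s _ (_ ++ _)) perm_catCA.
  move=> x xs; apply: (mm _ _ xs) => y; rewrite inE mem_cat.
  move=> /orP[/eqP->|/orP[/mapP[j jL ->]|yt]]; [by left| |by right; left].
  by right; right; exists j => //; left.
move=> rr; change (reg I ((a i ^+ e i :: [seq a i0 ^+ e i0 | i0 <- L']) ++ t)).
apply: (reg_perm iI _ _ rr); last first.
  by rewrite perm_sym /= -(cat1s _ (_ ++ _)) perm_catCA.
move=> x xs; apply: (mm _ _ xs) => y; rewrite mem_cat inE.
move=> /orP[/mapP[j jL ->]|/orP[/eqP->|yt]]; [|by left|by right; left].
by right; right; exists j => //; right.
Qed.
End Ideals.

(** * Koszul homology *)

Section Koszul.
Variable R : comNzRingType.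
Implicit Types (I J P Q X : set R) (bs : seq R).

Fixpoint koszul (k : nat) : lmodType R :=
  if k is k'.+1 then GRing.Lmodule.clone R (koszul k' * koszul k')%type _ else R^o.

(* The Koszul complex of b :: bs is the cone of multiplication by b on that of
   bs; all degrees are put together, and [kdeg j] singles out the j-th one. *)
Fixpoint kdiff bs : koszul (size bs) -> koszul (size bs) :=
  match bs with
  | [::] => fun=> 0
  | b :: bs' => fun u => (kdiff u.1 + b *: u.2, - kdiff u.2)
  end.

Fixpoint kdeg k j : koszul k -> Prop :=
  match k with
  | 0%N => fun u => j = 0%N \/ u = 0
  | k'.+1 => fun u => kdeg j u.1 /\ if j is j'.+1 then kdeg j' u.2 else u.2 = 0
  end.

(** Chains over R/I are represented by chains over R; these are the representatives of zero. *)
Fixpoint kin I k : koszul k -> Prop :=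
  match k with
  | 0%N => fun u => I u
  | k'.+1 => fun u => kin I u.1 /\ kin I u.2
  end.

Fixpoint kscal k (x : R) : koszul k :=
  match k with 0%N => x | k'.+1 => (kscal k' x, 0) end.

Lemma kscalDM k x b c : kscal k (x + c * b) = kscal k x + b *: kscal k c.
Proof.
elim: k => [|k IH] /=; first by rewrite [c * b]mulrC.
by rewrite IH; congr pair => /=; rewrite scaler0 addr0.
Qed.

Lemma kscalM k b c : kscal k (c * b) = b *: kscal k c.
Proof.
elim: k => [|k IH] /=; first by rewrite [c * b]mulrC.
by rewrite IH; congr pair => /=; rewrite scaler0.
Qed.

Lemma kdD bs u v : @kdiff bs (u + v) = kdiff u + kdiff v.
Proof.
elim: bs u v => [|b bs IH] u v /=; first by rewrite addr0.
rewrite !IH scalerDr opprD; congr pair => /=.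
by rewrite addrACA.
Qed.

Lemma kdZ bs c u : @kdiff bs (c *: u) = c *: kdiff u.
Proof.
elim: bs u => [|b bs IH] u /=; first by rewrite scaler0.
rewrite !IH; congr pair => /=; first by rewrite scalerDr !scalerA mulrC.
by rewrite scalerN.
Qed.

Lemma kdN bs u : @kdiff bs (- u) = - kdiff u.
Proof. by rewrite -scaleN1r kdZ scaleN1r. Qed.

Lemma kdB bs u v : @kdiff bs (u - v) = kdiff u - kdiff v.
Proof. by rewrite kdD kdN. Qed.

Lemma kd0 bs : @kdiff bs 0 = 0.
Proof. by have := @kdZ bs 0 0; rewrite !scale0r. Qed.

Lemma kdd bs u : @kdiff bs (kdiff u) = 0.
Proof.
elim: bs u => [|b bs IH] u //=.
rewrite kdD kdN kdZ !IH oppr0 add0r scalerN subrr oppr0; reflexivity.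
Qed.

Lemma kdegD k j (u v : koszul k) : kdeg j u -> kdeg j v -> kdeg j (u + v).
Proof.
elim: k j u v => [|k IH] j u v /=.
  by case=> [->|->]; [left | rewrite add0r].
move=> [u1 u2] [v1 v2]; split; first exact: IH.
by case: j u1 v1 u2 v2 => [|j] _ _; [move=> -> ->; rewrite addr0|apply: IH].
Qed.

Lemma kdegZ k j c (u : koszul k) : kdeg j u -> kdeg j (c *: u).
Proof.
elim: k j u => [|k IH] j u /=.
  by case=> [->|->]; [left | right; rewrite scaler0].
move=> [u1 u2]; split; first exact: IH.
by case: j u1 u2 => [|j] _; [move=> ->; rewrite scaler0|apply: IH].
Qed.

Lemma kdegN k j (u : koszul k) : kdeg j u -> kdeg j (- u).
Proof. by rewrite -scaleN1r; apply: kdegZ. Qed.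

Lemma kdegB k j (u v : koszul k) : kdeg j u -> kdeg j v -> kdeg j (u - v).
Proof. by move=> ju jv; apply: kdegD => //; apply: kdegN. Qed.

Lemma kdeg0 k j : kdeg j (0 : koszul k).
Proof.
elim: k j => [|k IH] j /=; first by right.
by split=> //; case: j.
Qed.

Lemma kdeg_top k j (u : koszul k) : (k < j)%N -> kdeg j u -> u = 0.
Proof.
elim: k j u => [|k IH] [|j] u //= kj; first by case.
case: u => u1 u2 /= [/IH -> //]; last exact: ltnW.
by move=> /IH ->.
Qed.

Lemma kdeg_scal k (u : koszul k) : kdeg 0 u -> exists x, u = kscal k x.
Proof.
elim: k u => [|k IH] u /=; first by exists u.
by case: u => u1 u2 /= [/IH[x ->] ->]; exists x.
Qed.

Lemma kscal_deg k x : kdeg 0 (kscal k x).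
Proof. by elim: k => [|k IH] /=; [left|]. Qed.

Lemma kd_deg0 bs u : kdeg 0 u -> @kdiff bs u = 0.
Proof.
elim: bs u => [|b bs IH] u //= [u1 u2].
by rewrite u2 IH // kd0 scaler0 addr0 oppr0.
Qed.

Lemma kd_deg bs j u : kdeg j.+1 u -> kdeg j (@kdiff bs u).
Proof.
elim: bs j u => [|b bs IH] j u /=; first by move=> _; right.
move=> [u1 u2]; split; first by apply: kdegD; [exact: IH|exact: kdegZ].
case: j u1 u2 => [|j] u1 u2; first by rewrite kd_deg0 // oppr0.
by apply: kdegN; apply: IH.
Qed.

Section In.
Variable I : set R.
Hypothesis iI : is_ideal I.

Lemma kinD k (u v : koszul k) : kin I u -> kin I v -> kin I (u + v).
Proof.
elim: k u v => [|k IH] u v /=; first exact: ideal_add.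
by move=> [u1 u2] [v1 v2]; split; apply: IH.
Qed.

Lemma kinZ k c (u : koszul k) : kin I u -> kin I (c *: u).
Proof.
elim: k u => [|k IH] u /=; first exact: ideal_mull.
by move=> [u1 u2]; split; apply: IH.
Qed.

Lemma kinN k (u : koszul k) : kin I u -> kin I (- u).
Proof. by rewrite -scaleN1r; apply: kinZ. Qed.

Lemma kinB k (u v : koszul k) : kin I u -> kin I v -> kin I (u - v).
Proof. by move=> ju jv; apply: kinD => //; apply: kinN. Qed.

Lemma kin0 k : kin I (0 : koszul k).
Proof. by elim: k => [|k IH] /=; [exact: ideal_zero|]. Qed.

Lemma kinDl k (u v : koszul k) : kin I u -> kin I (u + v) -> kin I v.
Proof. by move=> iu iuv; rewrite -[v](addKr u) addrC; apply: kinB. Qed.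

Lemma kin_mem k c (u : koszul k) : I c -> kin I (c *: u).
Proof.
move=> Ic; elim: k u => [|k IH] u /=; first exact: ideal_mulr.
by split; apply: IH.
Qed.

Lemma kin_scal k x : kin I (kscal k x) <-> I x.
Proof.
elim: k => [|k IH] //=; split; first by case=> /IH.
by move=> Ix; split; [exact/IH | exact: kin0].
Qed.

Lemma kd_kin bs u : kin I u -> kin I (@kdiff bs u).
Proof.
elim: bs u => [|b bs IH] u /=; first by move=> _; exact: ideal_zero.
move=> [u1 u2]; split; first by apply: kinD; [exact: IH|exact: kinZ].
by apply: kinN; apply: IH.
Qed.

Lemma kin_col k s (u : koszul k) : kin (colon1 I s) u <-> kin I (s *: u).
Proof.
elim: k u => [|k IH] u /=; first by rewrite /colon1 /= mulrC.
by rewrite !IH.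
Qed.

Lemma kin_addgen k j g (u : koszul k) : kin (addgen I g) u -> kdeg j u ->
  exists v, kdeg j v /\ kin I (u - g *: v).
Proof.
elim: k j u => [|k IH] j u /=.
  case=> c [y [Iy ->]] [->|->].
    exists c; split; [by left|rewrite mulrC addrK //].
  by exists 0; split; [by right|rewrite scaler0 subr0; apply: ideal_zero].
move=> [u1 u2] [/(IH _ _ u1)[v1 [dv1 iv1]]].
case: j dv1 u2 => [|j] dv1 u2 d2.
  exists (v1, 0); split=> //=; split=> //.
  by rewrite scaler0 subr0 d2; apply: kin0.
have [v2 [dv2 iv2]] := IH _ _ u2 d2.
by exists (v1, v2).
Qed.
End In.

Lemma kinS I J k (u : koszul k) : I `<=` J -> kin I u -> kin J u.
Proof.
move=> IJ; elim: k u => [|k IH] u /=; first exact: IJ.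
by move=> [u1 u2]; split; apply: IH.
Qed.

(* [c] annihilates the j-th Koszul homology of the sequence [bs] on R/I. *)
Definition kill bs I j c := forall u, kdeg j u -> kin I (@kdiff bs u) ->
  exists w, kdeg j.+1 w /\ kin I (c *: u - @kdiff bs w).

Lemma kill_mulr bs I j c d : is_ideal I -> kill bs I j c -> kill bs I j (d * c).
Proof.
move=> iI h u du cu; have [w [dw iw]] := h u du cu; exists (d *: w).
by split; [exact: kdegZ | rewrite kdZ -scalerA -scalerBr; apply: kinZ].
Qed.

Lemma kill_top bs I j c : is_ideal I -> (size bs < j)%N -> kill bs I j c.
Proof.
move=> iI sj u /(kdeg_top sj) -> _; exists 0; split; first exact: kdeg0.
by rewrite kd0 scaler0 subrr; apply: kin0.
Qed.

Lemma kill_mem bs I j c : is_ideal I -> I c -> kill bs I j c.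
Proof.
move=> iI Ic u _ _; exists 0; split; first exact: kdeg0.
by rewrite kd0 subr0; apply: kin_mem.
Qed.

(** Long exact sequence of 0 -> R/(I : g) -> R/I -> R/(I + (g)) -> 0, the first map being
    multiplication by g. *)
Lemma kill_ext bs I j g c c' : is_ideal I -> kill bs (colon1 I g) j c ->
  kill bs (addgen I g) j c' -> kill bs I j (c * c').
Proof.
move=> iI hc ha u du cu.
have [|w [dw iw]] := ha u du; first by apply: kinS cu; apply: sub_addgen.
have [|v [dv iv]] := kin_addgen iI iw (j := j).
  by apply: kdegB; [exact: kdegZ|exact: kd_deg].
have [|w' [dw' iw']] := hc v dv.
  apply/kin_col; rewrite -kdZ; move: (kd_kin iI iv).
  rewrite !kdB kdd subr0 kdZ => /(kinN iI); rewrite opprB => h.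
  apply: (kinDl iI (u := - (c' *: kdiff u))); first by apply: kinN => //; apply: kinZ.
  by rewrite addrC.
exists (c *: w + g *: w'); split; first by apply: kdegD; apply: kdegZ.
move: iw' => /kin_col iw'; move: (kinD iI (kinZ iI c iv) iw').
rewrite kdD !kdZ !scalerBr !scalerA [g * c]mulrC.
by rewrite addrA subrK opprD addrA.
Qed.

(** Since H_j(R/X) = 0, the connecting map from H_(j+1)(R/(X + (s))) to H_j(R/(X : s)) is
    surjective. *)
Lemma kill_shift bs X j s c : is_ideal X -> kill bs X j 1 ->
  kill bs (addgen X s) j.+1 c -> kill bs (colon1 X s) j c.
Proof.
move=> iX h1 hc u du /kin_col; rewrite -kdZ => su.
have [w [dw]] := h1 (s *: u) (kdegZ s du) su; rewrite scale1r => iw.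
have [|w' [dw' iw']] := hc w dw.
  rewrite -[kdiff w](subKr (s *: u)); apply: kinB; first exact: addgen_ideal.
    by apply: kin_mem; [exact: addgen_ideal|exact: mem_addgen].
  by apply: kinS iw; apply: sub_addgen.
have [|v [dv iv]] := kin_addgen iX iw' (j := j.+1).
  by apply: kdegB; [exact: kdegZ|exact: kd_deg].
exists v; split=> //; apply/kin_col; rewrite scalerBr -kdZ.
have := kinD iX (kinZ iX c iw) (kd_kin iX iv).
rewrite !kdB kdd subr0 kdZ scalerBr !scalerA [c * s]mulrC.
by rewrite addrA subrK.
Qed.

Lemma addgens_kd I bs x : is_ideal I -> addgens I bs x ->
  exists w, kdeg 1 w /\ kin I (kscal _ x - @kdiff bs w).
Proof.
move=> iI; elim: bs x => [|b bs IH] x /=.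
  by move=> Ix; exists 0; split; [right|rewrite subr0].
move=> [c [y [/IH[w [dw iw]] ->]]].
exists (w, kscal _ c); split=> /=; first by split=> //; apply: kscal_deg.
split; last by rewrite kd_deg0 ?oppr0 ?addr0; [exact: kin0|exact: kscal_deg].
move: iw; rewrite (_ : kscal _ (y + c * b) - _ = kscal _ y - kdiff w) //.
by rewrite kscalDM opprD addrACA subrr addr0.
Qed.

Lemma kd_addgens I bs w : is_ideal I -> kdeg 1 w ->
  exists x, @kdiff bs w = kscal _ x /\ addgens I bs x.
Proof.
move=> iI; elim: bs w => [|b bs IH] w /=; first by exists 0; split=> //; apply: ideal_zero.
move=> [/IH[x [-> Ax]] /kdeg_scal[c ->]].
exists (x + c * b); split; last by exists c, x.
rewrite kscalDM; congr pair.
by rewrite kd_deg0 ?oppr0 //; apply: kscal_deg.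
Qed.

(** Expanding v b over I and bs gives a 1-cycle with b-coordinate v, while modulo I the b-coordinate
    of a boundary lies in (bs). *)
Lemma kill_colon b bs I c v : is_ideal I -> kill (b :: bs) I 1 c ->
  addgens I bs (v * b) -> addgens I bs (c * v).
Proof.
move=> iI h /(addgens_kd iI)[w [dw iw]].
have [||[w1 w2] [[dw1 dw2]]] := h (- w, kscal _ v).
- by split=> /=; [exact: kdegN | exact: kscal_deg].
- split=> /=; last by rewrite kd_deg0 ?oppr0; [exact: kin0|exact: kscal_deg].
  by move: iw; rewrite kdN addrC kscalM.
case=> _ /=; rewrite opprK.
have [x [-> Ax]] := kd_addgens iI dw2.
rewrite addrC -kscalDM mulrC addrC.
move=> /(kin_scal iI) Icx; have iA := addgens_ideal bs iI.
rewrite -[c * v](addrK x); apply: ideal_sub => //.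
exact: sub_addgens Icx.
Qed.

(** In the long exact sequence of the cone, regularity enters at H_0 = R/(I + (bs)), where
    multiplication by b is injective. *)
Lemma reg_kill I bs j : is_ideal I -> reg I bs -> kill bs I j.+1 1.
Proof.
move=> iI; elim: bs j => [|b bs IH] j.
  by move=> _; apply: kill_top.
move=> [rs hb] [u v] [/= du dv] [/= iu /(kinN iI)]; rewrite opprK => iv.
have {IH} IH k : kill bs I k.+1 1 by apply: IH.
have [v' [dv' iv']] : exists v', kdeg j.+1 v' /\ kin I (v - kdiff v').
  case: j du dv => [|j] du dv.
    have [y vE] := kdeg_scal dv; have [x [uE Ax]] := kd_addgens iI du.
    rewrite vE; apply: addgens_kd => //; apply: hb.
    move: iu; rewrite uE vE.
    rewrite -kscalDM => /(kin_scal iI)/(@sub_addgens _ _ bs).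
    by apply: ideal_addKl => //; apply: addgens_ideal.
  by have [w [dw]] := IH j v dv iv; rewrite scale1r => iw; exists w.
have [||w [dw]] := IH j (u + b *: v').
- by apply: kdegD => //; apply: kdegZ.
- rewrite kdD kdZ -[b *: kdiff v'](subKr (b *: v)) addrA -scalerBr.
  by apply: kinB => //; apply: kinZ.
rewrite scale1r => iw; exists (w, - v'); split=> /=.
  by split=> //; apply: kdegN.
rewrite !scale1r kdN !opprK; split; last exact: iv'.
by rewrite scalerN opprB addrA.
Qed.

(** Exponent for degree j, where j + k = size + 1: going down one degree multiplies it by a
    filtration length at most r, and the added 1 keeps it positive for primes that contain a. *)
Fixpoint kexp (r k : nat) := if k is k'.+1 then (r * kexp r k').+1 else 1%N.

(** * Annihilators of Koszul homology independent of the exponents *)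

Section Killing.
Variables (PP : set R -> Prop) (a : R) (bs : seq R) (r0 : nat).

Lemma kill_filt r I j c : (forall P, PP P -> kill bs P j c) -> is_ideal I ->
  filt PP r I -> kill bs I j (c ^+ r).
Proof.
move=> h iI fI; elim: fI iI => {r I} [I I1 iI|r I g Pg _ IH iI].
  by apply: kill_mem => //; apply: ideal_unit.
by rewrite exprS; apply: (kill_ext iI (h _ Pg)); apply: IH; apply: addgen_ideal.
Qed.

Hypothesis hPP : forall P, PP P -> is_ideal P /\ (P a \/ exists X s r,
  [/\ is_ideal X, P = colon1 X s, (r <= r0)%N, filt PP r (addgen X s) &
      forall j, kill bs X j.+1 1]).

(* Descending induction on the degree: R/(X : s) embeds into R/X, which has no
   higher Koszul homology. *)
Lemma kill_family k j P : PP P -> (j + k = (size bs).+1)%N -> (0 < j)%N ->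
  kill bs P j (a ^+ kexp r0 k).
Proof.
elim: k j P => [|k IH] j P PP_P jk j0.
  by have [iP _] := hPP PP_P; apply: kill_top => //; rewrite -jk addn0.
have [iP [Pa|[X [s [r [iX PE rr0 fX hX]]]]]] := hPP PP_P.
  by apply: kill_mem => //=; rewrite exprS; apply: ideal_mulr.
rewrite PE /=; apply: kill_shift => //; first by case: j j0 {jk}.
have hk Q : PP Q -> kill bs Q j.+1 (a ^+ kexp r0 k).
  by move=> PQ; apply: IH => //; rewrite addSnnS.
have := kill_filt hk (addgen_ideal s iX) fX.
rewrite -exprM => h.
have -> : (r0 * kexp r0 k).+1 = ((r0 * kexp r0 k).+1 - kexp r0 k * r + kexp r0 k * r)%N.
  by rewrite subnK // [(kexp _ _ * _)%N]mulnC ltnW // ltnS leq_mul2r rr0 orbT.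
by rewrite exprD; apply: kill_mulr => //; apply: addgen_ideal.
Qed.
End Killing.
End Koszul.

(** * Injective resolutions *)

Section IdealModule.
Variables (R : comNzRingType) (J : set R) (iJ : is_ideal J).

Definition ideal_pred : {pred R^o} := fun x => `[< J x >].

Fact ideal_pred_closed : submod_closed ideal_pred.
Proof.
split; first by apply/asboolP; exact: (ideal_zero iJ).
move=> a u v /asboolP Ju /asboolP Jv; apply/asboolP.
exact: (ideal_add iJ (ideal_mull a iJ Ju) Jv).
Qed.

HB.instance Definition _ := GRing.isSubmodClosed.Build R R^o ideal_pred
  (GRing.submod_closed_semi ideal_pred_closed).

Record ideal_module := IdealModule {ideal_val : R^o; _ : ideal_val \in ideal_pred}.
HB.instance Definition _ := [isSub for ideal_val].
HB.instance Definition _ := [Choice of ideal_module by <:].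
HB.instance Definition _ := [SubChoice_isSubLmodule of ideal_module by <:].

Lemma injective_extend (E : lmodType R) (f : R -> E) : injective_module E ->
  (forall x y, J x -> J y -> f (x + y) = f x + f y) ->
  (forall c x, J x -> f (c * x) = c *: f x) ->
  exists e, forall x, J x -> f x = x *: e.
Proof.
move=> injE fD fZ.
have Jv (x : ideal_module) : J (ideal_val x) by case: x => x /= /asboolP.
pose h (x : ideal_module) := f (ideal_val x).
have hlin : linear h.
  move=> c x y; rewrite /h -fZ // -fD //; last by apply: ideal_mull => //; apply: Jv.
pose hL : {linear ideal_module -> E} := HB.pack h (GRing.isLinear.Build _ _ _ _ h hlin).
have [g gE] := injE _ _ (\val : {linear ideal_module -> R^o}) hL val_inj.
exists (g 1) => x Jx.
have xJ : (x : R^o) \in ideal_pred by apply/asboolP.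
pose x' := IdealModule xJ.
rewrite -[f x]/(hL x') -gE -linearZ; congr (g _).
by rewrite /= -[RHS]/(x * 1) mulr1.
Qed.
End IdealModule.

(** Surjectivity of Hom(R/I, E) -> Hom(R/(I : g), E) for the embedding by g: the map y + c g |-> c e
    on I + (g) is well defined, as c is determined modulo (I : g), and it extends to R. *)
Lemma injective_lift (R : comNzRingType) (E : lmodType R) (I : set R) g (e : E) :
  injective_module E -> is_ideal I -> (forall v, colon1 I g v -> v *: e = 0) ->
  exists2 e', (forall v, I v -> v *: e' = 0) & g *: e' = e.
Proof.
move=> injE iI he; have iJ := addgen_ideal g iI.
have /choice[c cP] x : exists c, addgen I g x -> I (x - c * g).
  have [[c [y [Iy ->]]]|] := pselect (addgen I g x); last by exists 0.
  by exists c => _; rewrite addrK.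
have cE x d : addgen I g x -> I (x - d * g) -> c x *: e = d *: e.
  move=> /cP h1 h2; apply/eqP; rewrite -subr_eq0 -scalerBl; apply/eqP/he.
  rewrite /colon1 /= (_ : _ * g = (x - d * g) - (x - c x * g)); last by ring.
  exact: ideal_sub.
have [||e' e'P] := injective_extend iJ (f := fun x => c x *: e) injE.
- move=> x y Jx Jy; rewrite -scalerDl; apply: cE; first exact: ideal_add.
  rewrite (_ : _ - _ = (x - c x * g) + (y - c y * g)); last by ring.
  by apply: ideal_add => //; apply: cP.
- move=> a x Jx; rewrite scalerA; apply: cE; first exact: ideal_mull.
  rewrite -mulrA -mulrBr; apply: ideal_mull => //; exact: cP.
exists e' => [v Iv|].
  rewrite -e'P; last exact: sub_addgen.
  by rewrite (cE v 0) ?scale0r ?mul0r ?subr0 //; apply: sub_addgen.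
rewrite -e'P; last exact: mem_addgen.
rewrite (cE g 1) ?scale1r //; first exact: mem_addgen.
by rewrite mul1r subrr; apply: ideal_zero.
Qed.

Section Resolution.
Variable R : comNzRingType.
Hypothesis nR : noeth R.
Variables (E : nat -> lmodType R) (eta : {linear R^o -> E 0%N})
  (dd : forall i, {linear E i -> E i.+1}) (n : nat).
Implicit Types (I J P Q X : set R).

(* [ann I i], [cyc I i] and [bd I i] are the cochains, cocycles and coboundaries of
   Hom(R/I, E), whose cohomology is Ext^i(R/I, R). *)
Definition ann I i : set (E i) := [set e | forall v, I v -> v *: e = 0].

Definition cyc I i : set (E i) := [set e | ann I e /\ dd i e = 0].

Definition bd I i : set (E i) :=
  match i with
  | 0%N => [set 0]
  | j.+1 => [set e | exists2 f : E j, ann I f & e = dd j f]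
  end.

Hypothesis lift : forall i I g (e : E i), is_ideal I -> ann (colon1 I g) e ->
  exists2 e', ann I e' & g *: e' = e.
Hypothesis eta_inj : injective eta.
Hypothesis exact0 : forall e, dd 0%N e = 0 -> exists v, e = eta v.
Hypothesis dd_eta : forall v, dd 0%N (eta v) = 0.
Hypothesis exactS : forall i e, dd i.+1 e = 0 -> exists f, e = dd i f.
Hypothesis dddd : forall i e, dd i.+1 (dd i e) = 0.
Hypothesis E_top : forall i, (n < i)%N -> forall e : E i, e = 0.

Definition submod (M : lmodType R) (U : set M) :=
  [/\ U 0, forall e f, U e -> U f -> U (e + f) & forall c e, U e -> U (c *: e)].

Lemma submodB (M : lmodType R) (U : set M) e f : submod U -> U e -> U f -> U (e - f).
Proof. by case=> _ D Z Ue Uf; apply: D => //; rewrite -scaleN1r; apply: Z. Qed.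

Lemma ann_submod I i : submod (@ann I i).
Proof.
split=> [v _|e f ae af v Iv|c e ae v Iv]; first by rewrite scaler0.
  by rewrite scalerDr ae // af // addr0.
by rewrite scalerA mulrC -scalerA ae // scaler0.
Qed.

Lemma bd_submod I i : submod (@bd I i).
Proof.
case: i => [|i] /=.
  by split=> [//|_ _ -> ->|c _ ->]; rewrite ?addr0 ?scaler0.
have [a0 aD aZ] := ann_submod I i; split.
- by exists 0; rewrite ?linear0.
- by move=> _ _ [e ae ->] [f af ->]; exists (e + f); rewrite ?linearD //; apply: aD.
- by move=> c _ [e ae ->]; exists (c *: e); rewrite ?linearZ //; apply: aZ.
Qed.

Lemma cyc_submod I i : submod (@cyc I i).
Proof.
have [a0 aD aZ] := ann_submod I i; split.
- by split=> //; rewrite linear0.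
- by move=> e f [ae de] [af df]; split; [exact: aD|rewrite linearD de df addr0].
- by move=> c e [ae de]; split; [exact: aZ|rewrite linearZ /= de scaler0].
Qed.

Lemma annS I J i : I `<=` J -> @ann J i `<=` @ann I i.
Proof. by move=> IJ e ae v /IJ/ae. Qed.

Lemma cycS I J i : I `<=` J -> @cyc J i `<=` @cyc I i.
Proof. by move=> IJ e [/(annS IJ)]. Qed.

Lemma bdS I J i : I `<=` J -> @bd J i `<=` @bd I i.
Proof. by case: i => [|i] IJ e //= [f /(annS IJ) af ->]; exists f. Qed.

Lemma dd_ann I i e : @ann I i e -> ann I (dd i e).
Proof. by move=> ae v Iv; rewrite -linearZ ae // linear0. Qed.

Lemma dd_bd I i e : @bd I i e -> dd i e = 0.
Proof. by case: i e => [|i] /= e; [move=> ->; rewrite linear0|case=> f _ ->; rewrite dddd]. Qed.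

Lemma bd_ann I i : @bd I i `<=` @ann I i.
Proof.
case: i => [|i] /= e; last by case=> f af ->; apply: dd_ann.
by move=> ->; case: (ann_submod I 0).
Qed.

Lemma bd_cyc I i : @bd I i `<=` @cyc I i.
Proof. by move=> e be; split; [exact: bd_ann | exact: dd_bd be]. Qed.

Lemma dd_boundary I i e : @ann I i e -> bd I (dd i e).
Proof. by move=> ae; exists e. Qed.

Lemma ann_colon I g i e : @ann I i e -> ann (colon1 I g) (g *: e).
Proof. by move=> ae v Ivg; rewrite scalerA ae. Qed.

Lemma cyc_colon I g i e : @cyc I i e -> cyc (colon1 I g) (g *: e).
Proof. by move=> [ae de]; split; [exact: ann_colon|rewrite linearZ /= de scaler0]. Qed.

Lemma bd_colon I g i e : @bd I i e -> bd (colon1 I g) (g *: e).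
Proof.
case: i e => [|i] /= e; first by move=> ->; rewrite scaler0.
by case=> f af ->; exists (g *: f); [exact: ann_colon|rewrite linearZ].
Qed.

Lemma ann_addgen I g i e : @ann I i e -> g *: e = 0 -> ann (addgen I g) e.
Proof.
by move=> ae ge _ [c [y [Iy ->]]]; rewrite scalerDl -scalerA ge ae // scaler0 addr0.
Qed.

Lemma addgen_ann I g i e : is_ideal I -> @ann (addgen I g) i e -> g *: e = 0.
Proof. by move=> iI; apply; apply: mem_addgen. Qed.

Lemma bd_lift I g i e : is_ideal I -> bd (colon1 I g) e ->
  exists2 e' : E i, bd I e' & g *: e' = e.
Proof.
move=> iI; case: i e => [|i] /= e; first by move=> ->; exists 0; rewrite ?scaler0.
by case=> f /(lift iI)[f' af' <-] ->; exists (dd i f'); [exists f'|rewrite linearZ].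
Qed.

(** [dd i e] represents the image of [g *: e] under the connecting map Ext^i(R/(I : g)) ->
    Ext^(i+1)(R/(I + (g))). *)
Lemma connecting_cyc I g i e : is_ideal I -> @ann I i e -> dd i (g *: e) = 0 ->
  cyc (addgen I g) (dd i e).
Proof.
move=> iI ae; rewrite linearZ /= => gde.
by split; [apply: ann_addgen => //; apply: dd_ann | exact: dddd].
Qed.

Lemma les_mid I g i e : is_ideal I -> @cyc I i e -> bd (colon1 I g) (g *: e) ->
  exists2 f, cyc (addgen I g) f & bd I (e - f).
Proof.
move=> iI [ae de] /(bd_lift iI)[e' be' ge'].
exists (e - e').
  split; last by rewrite linearB /= de (dd_bd be') subr0.
  apply: ann_addgen; last by rewrite scalerBr ge' subrr.
  by apply: (submodB (ann_submod I i)) => //; exact: bd_ann.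
by rewrite subKr.
Qed.

(** * Long exact Ext sequences at a prime, with denominators cleared *)

Section Local.
Variable Q : set R.
Hypothesis pQ : is_prime Q.

(* Ext^i(R/I, R) vanishes at Q. *)
Definition vanish I i := forall e : E i, cyc I e -> exists2 s, ~ Q s & bd I (s *: e).

(** The obstruction to lifting along Ext^i(R/I) -> Ext^i(R/(I : g)) lives in Ext^(i+1)(R/(I + (g))),
    so a factor outside Q removes it. *)
Lemma les_lift I g i e : is_ideal I -> vanish (addgen I g) i.+1 ->
  cyc (colon1 I g) e -> exists2 s, ~ Q s & exists2 z : E i, cyc I z & g *: z = s *: e.
Proof.
move=> iI V [/(lift iI)[e' ae' <-] de].
have [s ns [f af sf]] := V _ (connecting_cyc iI ae' de).
exists s => //; exists (s *: e' - f).
  split; last by rewrite linearB linearZ /= sf subrr.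
  apply: (submodB (ann_submod I i)); last by apply: annS af; apply: sub_addgen.
  by case: (ann_submod I i) => _ _ aZ; exact: aZ.
by rewrite scalerBr (addgen_ann iI af) subr0 !scalerA mulrC.
Qed.

Lemma vanish_mid I g i : is_ideal I -> vanish (addgen I g) i -> vanish (colon1 I g) i ->
  vanish I i.
Proof.
move=> iI Va Vc e ce.
have [s ns] := Vc _ (cyc_colon g ce).
rewrite scalerA mulrC -scalerA => bs.
have cse : cyc I (s *: e) by case: (cyc_submod I i) => _ _ cZ; exact: cZ.
have [f cf bf] := les_mid iI cse bs.
have [s' ns' bf'] := Va _ cf.
have [b0 bD bZ] := bd_submod I i.
exists (s' * s); first exact: primeM.
rewrite -scalerA -[s *: e](subrK f) scalerDr; apply: bD; first exact: bZ.
by apply: bdS bf'; apply: sub_addgen.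
Qed.

Lemma vanish_out I i s : I s -> ~ Q s -> vanish I i.
Proof.
by move=> Is ns e [ae _]; exists s => //; rewrite ae //; case: (bd_submod I i).
Qed.
End Local.

(** Finite generation of W modulo B. Quantifying over U lets each use pick a submodule instead of
    handling linear combinations. *)
Definition fgen (M : lmodType R) (W B : set M) := exists ws : seq M,
  (forall w, w \in ws -> W w) /\
  forall U, submod U -> B `<=` U -> (forall w, w \in ws -> U w) -> W `<=` U.

Lemma etaD x y : eta (x + y) = eta x + eta y. Proof. exact: linearD. Qed.
Lemma etaZ c x : eta (c * x) = c *: eta x. Proof. exact: (linearZ_LR eta c x). Qed.
Lemma eta0 : eta 0 = 0. Proof. exact: linear0. Qed.

Lemma eta_preim (U : set (E 0)) : submod U -> is_ideal [set v | U (eta v)].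
Proof.
move=> [U0 UD UZ]; split=> /=; first by rewrite eta0.
  by move=> x y Ux Uy; rewrite etaD; apply: UD.
by move=> c x Ux; rewrite etaZ; apply: UZ.
Qed.

(** Ext^i(R/I, R) is a noetherian module. Induction on i, then on the generators of I, by exactness
    of Ext^i(R/(I : g)) -> Ext^(i+1)(R/(I + (g))) -> Ext^(i+1)(R/I). The outer induction covers all
    ideals, since (I : g) may need more generators. *)
Lemma noetherian_cohomology i I (W : set (E i)) : is_ideal I ->
  submod W -> @bd I i `<=` W -> W `<=` @cyc I i -> fgen W (@bd I i).
Proof.
elim: i I W => [|i IHi] I W iI;
  have [k [g0 gE]] := nR iI; rewrite {}gE ideal_gen_addgens in iI *;
  elim: (codom g0) W iI => {k g0 I} [|g s IHs] W iI sW bW Wc.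
- have iW0 := eta_preim sW.
  have [k [g gE]] := nR iW0.
  exists [seq eta (g t) | t <- enum 'I_k]; split.
    move=> _ /mapP[t _ ->]; have : [set v | W (eta v)] (g t).
      by rewrite gE; apply: mem_ideal_gen.
    by [].
  move=> U sU bU wU w Ww; have [_ /exact0[v vE]] := Wc _ Ww.
  suff: [set v | W (eta v)] `<=` [set v | U (eta v)] by rewrite vE; apply; rewrite /= -vE.
  rewrite gE; apply: ideal_gen_min => [|t] /=; first exact: eta_preim.
  by apply: wU; apply: map_f; rewrite mem_enum.
- have iIs : is_ideal (addgens [set 0] s) by apply: addgens_ideal; exact: zero_ideal.
  have [|ws [wW wsU]] := IHs W iIs sW bW.
    by apply: subset_trans Wc _; apply: cycS; apply: sub_addgen.
  by exists ws.
- exists [::]; split=> // U _ bU _; apply: subset_trans bU => w /Wc [_ /exactS[f ->]].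
  apply: dd_boundary => v /= ->; exact: scale0r.
pose I := addgens [set 0] s.
have iIs : is_ideal I by apply: addgens_ideal; exact: zero_ideal.
have [W_0 WD WZ] := sW.
have [b0 bD bZ] := bd_submod I i.+1.
(* [W1] is the image of W in Ext^(i+1)(R/I); [W2] below is its preimage under the connecting map. *)
pose W1 : set (E i.+1) := [set z | exists2 w, W w & bd I (z - w)].
have sW1 : submod W1.
  split; first by exists 0; rewrite ?subr0.
    move=> e f [w Ww be] [w' Ww' bf]; exists (w + w'); first exact: WD.
    by rewrite opprD addrACA; apply: bD.
  move=> c e [w Ww be]; exists (c *: w); first exact: WZ.
  by rewrite -scalerBr; apply: bZ.
have WW1 : W `<=` W1 by move=> w Ww; exists w; rewrite ?subrr.
have [||ws1 [w1W ws1U]] := IHs W1 iIs sW1.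
- by move=> b bb; exists 0; rewrite ?subr0.
- move=> z [w /Wc /(cycS (@sub_addgen _ I g)) cw /bd_cyc czw].
  rewrite -[z](subrK w).
  by case: (cyc_submod I i.+1) => _ cD _; apply: cD.
have [ws1' [w1'W ws1'P]] : exists ws1' : seq (E i.+1), (forall w, w \in ws1' -> W w) /\
    forall z, z \in ws1 -> exists2 w, w \in ws1' & bd I (z - w).
  elim: (ws1) w1W => [|z l IHl] h; first by exists [::].
  have [|l' [h1 h2]] := IHl; first by move=> w wl; apply: h; rewrite inE wl orbT.
  have [w Ww bw] := h z (mem_head _ _).
  exists (w :: l'); split; first by move=> w'; rewrite inE => /orP[/eqP->|/h1].
  move=> z'; rewrite inE => /orP[/eqP->|/h2[w' w'l bw']].
    by exists w; rewrite ?mem_head.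
  by exists w' => //; rewrite inE w'l orbT.
pose W2 : set (E i) := [set f | cyc (colon1 I g) f /\
  exists e', [/\ ann I e', g *: e' = f & W (dd i e')]].
have [c0 cD cZ] := cyc_submod (colon1 I g) i.
have [a0 aD aZ] := ann_submod I i.
have sW2 : submod W2.
  split; first by split=> //; exists 0; rewrite scaler0 linear0.
    move=> e1 f1 [ce [e [ae ge We]]] [cf [f [af gf Wf]]]; split; first exact: cD.
    exists (e + f); rewrite scalerDr linearD ge gf.
    by split=> //; [exact: aD|exact: WD].
  move=> c e1 [ce [e [ae ge We]]]; split; first exact: cZ.
  exists (c *: e); rewrite [g *: _]scalerA mulrC -scalerA ge linearZ.
  by split=> //; [exact: aZ|exact: WZ].
have [||ws2 [w2W ws2U]] := IHi (colon1 I g) W2 (colon1_ideal g iIs) sW2.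
- move=> f bf; split; first exact: bd_cyc.
  have [e' be' <-] := bd_lift iIs bf; exists e'; split=> //; first exact: bd_ann.
  by rewrite (dd_bd be').
- by move=> f [].
have [ws2' [w2'W ws2'P]] : exists ws2' : seq (E i), (forall w, w \in ws2' -> W (dd i w)) /\
    forall z, z \in ws2 -> exists2 w, w \in ws2' & ann I w /\ g *: w = z.
  elim: (ws2) w2W => [|z l IHl] h; first by exists [::].
  have [|l' [h1 h2]] := IHl; first by move=> w wl; apply: h; rewrite inE wl orbT.
  have [_ [w [aw gw Ww]]] := h z (mem_head _ _).
  exists (w :: l'); split; first by move=> w'; rewrite inE => /orP[/eqP->|/h1].
  move=> z'; rewrite inE => /orP[/eqP->|/h2[w' w'l bw']].
    by exists w; rewrite ?mem_head.
  by exists w' => //; rewrite inE w'l orbT.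
exists (ws1' ++ [seq dd i w | w <- ws2']); split.
  by move=> w; rewrite mem_cat => /orP[/w1'W//|/mapP[w' /w2'W ? ->]].
move=> U sU bU wsU w Ww; have [U0 UD UZ] := sU.
pose U1 : set (E i.+1) := [set z | exists u, [/\ U u, W u & bd I (z - u)]].
have sU1 : submod U1.
  split; first by exists 0; rewrite ?subr0.
    move=> e f [u [Uu Wu be]] [u' [Uu' Wu' bf]]; exists (u + u').
    by rewrite opprD addrACA; split; [exact: UD|exact: WD|exact: bD].
  move=> c e [u [Uu Wu be]]; exists (c *: u).
  by rewrite -scalerBr; split; [exact: UZ|exact: WZ|exact: bZ].
have [||u [Uu Wu bu]] := ws1U U1 sU1 _ _ w (WW1 _ Ww).
- by move=> b bb; exists 0; rewrite subr0.
- move=> z /ws1'P[u uws bzu]; exists u; split=> //; last exact: w1'W.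
  by apply: wsU; rewrite mem_cat uws.
rewrite -[w](subrK u); apply: (UD) => //.
have Wwu : W (w - u) by apply: (submodB sW).
case: bu => e ae wuE; rewrite wuE in Wwu *.
have cge : cyc (colon1 I g) (g *: e).
  split; first exact: ann_colon.
  by rewrite linearZ /=; case: (Wc _ Wwu) => /(addgen_ann iIs).
pose U2 : set (E i) := [set f | exists e', [/\ ann I e', g *: e' = f & U (dd i e')]].
have sU2 : submod U2.
  split; first by exists 0; rewrite scaler0 linear0.
    move=> _ _ [e1 [ae1 <- Ue1]] [f [af <- Uf]].
    by exists (e1 + f); rewrite scalerDr linearD; split=> //; [exact: aD|exact: UD].
  move=> c _ [e1 [ae1 <- Ue1]].
  exists (c *: e1); rewrite [g *: _]scalerA mulrC -scalerA (linearZ_LR (dd i)).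
  by split=> //; [exact: aZ|exact: UZ].
have [|||e' [ae' ge' Ue']] := ws2U U2 sU2 _ _ (g *: e).
- move=> f bf; have [e' be' <-] := bd_lift iIs bf.
  by exists e'; rewrite (dd_bd be'); split=> //; apply: bd_ann.
- move=> z /ws2'P[e' ews [ae' ge']]; exists e'; split=> //.
  by apply: wsU; rewrite mem_cat map_f ?orbT.
- by split=> //; exists e.
rewrite -[e](subrK e') linearD; apply: UD => //; apply: bU.
apply: dd_boundary; apply: ann_addgen.
  by apply: (submodB (ann_submod I i)).
by rewrite scalerBr ge' subrr.
Qed.

Lemma reg_colon1 I x xs : is_ideal I -> reg I (x :: xs) ->
  colon1 (addgens I xs) x = addgens I xs.
Proof.
move=> iI [_ h]; rewrite eqEsubset; split; first exact: h.
by apply: sub_colon1; apply: addgens_ideal.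
Qed.

Lemma reg_exact xs i e : reg [set 0] xs -> (size xs < i)%N ->
  @cyc (addgens [set 0] xs) i e -> bd (addgens [set 0] xs) e.
Proof.
elim: xs i e => [|x xs IH] [|i] e // rxs si.
  move=> [_ /exactS[f ->]]; apply: dd_boundary => v /= ->; exact: scale0r.
set X := addgens _ xs in IH *; move=> ce.
have iX : is_ideal X by apply: addgens_ideal; apply: zero_ideal.
have xX : colon1 X x = X by apply: reg_colon1 rxs; exact: zero_ideal.
have [rxs' _] := rxs.
have [f af eE] : bd X e.
  by apply: IH => //; [exact: ltnW | apply: cycS ce; apply: sub_addgen].
rewrite /= ltnS in si.
have cxf : cyc X (x *: f).
  split; first by case: (ann_submod X i) => _ _ aZ; apply: aZ.
  by rewrite linearZ /= -eE; case: ce => /(addgen_ann iX).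
have := IH _ _ rxs' si cxf; rewrite -{1}xX => /(bd_lift iX)[g' bg' xg'].
have -> : e = dd i (f - g') by rewrite linearB /= (dd_bd bg') subr0.
apply: dd_boundary; apply: ann_addgen; last by rewrite scalerBr xg' subrr.
by apply: (submodB (ann_submod X i)) => //; apply: bd_ann.
Qed.

(* Ext^i(R/(xs), R) is R/(xs) for i = size xs and 0 otherwise. *)
Lemma reg_generator xs : reg [set 0] xs ->
  exists eps : E (size xs), [/\ cyc (addgens [set 0] xs) eps,
    forall e, cyc (addgens [set 0] xs) e -> exists v, bd (addgens [set 0] xs) (e - v *: eps) &
    forall v, bd (addgens [set 0] xs) (v *: eps) -> addgens [set 0] xs v].
Proof.
elim: xs => [|x xs IH] rxs.
  exists (eta 1); split=> [|e [_ /exact0[v ->]]|v] /=.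
  - by split; [move=> v /= ->; rewrite scale0r | exact: dd_eta].
  - by exists v; rewrite -etaZ mulr1 subrr.
  - by rewrite -etaZ mulr1 -eta0 => /eta_inj.
have [rxs' _] := rxs; have [eps [ceps gen inj]] := IH rxs'.
have xX : colon1 (addgens [set 0] xs) x = addgens [set 0] xs.
  by apply: reg_colon1 rxs; exact: zero_ideal.
rewrite /=; set X := addgens _ xs in xX gen inj ceps *.
have iX : is_ideal X by apply: addgens_ideal; apply: zero_ideal.
have [aeps deps] := ceps.
move: (aeps); rewrite -{1}xX => /(lift iX)[ep aep xep].
have [b0 bD bZ] := bd_submod X (size xs).
have [a0 aD aZ] := ann_submod X (size xs).
exists (dd _ ep); split.
- by apply: connecting_cyc => //; rewrite xep.
- move=> e ce; have [f af eE] : bd X e.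
    by apply: reg_exact => //; apply: cycS ce; apply: sub_addgen.
  have cxf : cyc X (x *: f).
    split; first exact: aZ.
    by rewrite linearZ /= -eE; case: ce => /(addgen_ann iX).
  have [v] := gen _ cxf; rewrite -{1}xX => /(bd_lift iX)[g' bg' xg'].
  exists v; rewrite eE -linearZ -linearB /=.
  have -> : dd _ (f - v *: ep) = dd _ (f - v *: ep - g').
    by rewrite [RHS]linearB /= (dd_bd bg') subr0.
  apply: dd_boundary; apply: ann_addgen.
    apply: (submodB (ann_submod X _)); last exact: bd_ann.
    by apply: (submodB (ann_submod X _)) => //; apply: aZ.
  by rewrite !scalerBr xg' scalerA [x * v]mulrC -scalerA xep subrr.
- move=> v [f af]; rewrite -linearZ => vE.
  have cvf : cyc X (v *: ep - f).
    split; last by rewrite linearB /= vE subrr.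
    by apply: (submodB (ann_submod X _)); [exact: aZ|apply: annS af; apply: sub_addgen].
  have [w bw] := gen _ cvf.
  have /inj Xvw : bd X ((v - w * x) *: eps).
    have := bZ x _ bw; rewrite !scalerBr (addgen_ann iX af) subr0 !scalerA.
    by rewrite [x * v]mulrC -(scalerA v x) xep scalerBl [w * x]mulrC.
  by exists w, (v - w * x); split=> //; rewrite subrK.
Qed.

(** * Unmixedness from finite injective dimension *)

Section CohenMacaulay.
Variables (xs : seq R) (Q : set R) (s : R).
Hypothesis rxs : reg [set 0] xs.
Hypothesis pQ : is_prime Q.
Let X := addgens [set 0] xs.
Hypothesis QE : Q = colon1 X s.

Let iX : is_ideal X. Proof. by apply: addgens_ideal; apply: zero_ideal. Qed.

(** Descending induction on i from the end of the resolution; in each degree, noetherian induction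
    reduces to a prime I inside Q. If I = Q, then R/Q embeds into R/X and Ext^i(R/X) = 0 surjects
    onto Ext^i(R/Q) at Q. Otherwise some y in Q is regular on R/I, so it acts surjectively on the
    finitely generated Ext^i(R/I) at Q, and Nakayama applies. *)
Lemma vanish_above i I : (size xs < i)%N -> is_ideal I -> vanish Q I i.
Proof.
have [k nk] : exists k, (n < i + k)%N by exists n.+1; rewrite addnS ltnS leq_addl.
elim: k i nk I => [|k IHk] i nk I si.
  move=> _ e _; exists 1; first by case: pQ.
  rewrite addn0 in nk; rewrite (E_top nk (_ *: _)).
  by case: (bd_submod I i).
move: I; apply: noeth_ind => // I iI IH.
have Vi1 J : is_ideal J -> vanish Q J i.+1.
  by move=> iJ; apply: IHk => //; [rewrite addSnnS | exact: ltnW].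
have [IQ|/nonsubset[v [Iv Qv]]] := pselect (I `<=` Q); last exact: (vanish_out Iv Qv).
have [pI|npI] := pselect (is_prime I); last first.
  have [u [v [Iuv nu nv]]] : exists u v, [/\ I (u * v), ~ I u & ~ I v].
    apply: contrapT => h; apply: npI; split=> //; first by move=> /IQ; case: pQ.
    move=> u v Iuv; apply: contrapT => /not_orP[nu nv].
    by apply: h; exists u, v.
  apply: (vanish_mid pQ (g := u) iI); apply: IH.
  - exact: addgen_ideal.
  - by split; [exact: sub_addgen | move=> /(_ _ (mem_addgen u iI))].
  - exact: colon1_ideal.
  - split; first exact: sub_colon1.
    by move=> /(_ v); rewrite /colon1 /= mulrC => /(_ Iuv).
have [QI|/nonsubset[y [Qy nIy]]] := pselect (Q `<=` I).
  have {QI} IE : I = colon1 X s by rewrite -QE eqEsubset.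
  move=> e; rewrite {1}IE => ce.
  have [t nt [z cz zE]] := les_lift iX (Vi1 _ (addgen_ideal s iX)) ce.
  exists t => //; rewrite -zE IE; apply: bd_colon.
  exact: reg_exact.
have [iI' I1 IM] := pI.
have yI : colon1 I y = I.
  rewrite eqEsubset; split; last exact: sub_colon1.
  by move=> v /IM[].
have [ws [wsc wsU]] : fgen (@cyc I i) (@bd I i).
  by apply: noetherian_cohomology => //; [exact: cyc_submod | exact: bd_cyc].
have [b0 bD bZ] := bd_submod I i.
have span z : cyc I z -> exists c : 'I_(size ws) -> R,
    bd I (z - \sum_t c t *: tnth (in_tuple ws) t).
  pose U := [set z | exists c : 'I_(size ws) -> R,
    @bd I i (z - \sum_t c t *: tnth (in_tuple ws) t)].
  suff: @cyc I i `<=` U by apply.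
  apply: wsU.
  - split.
    + by exists (fun=> 0); rewrite big1 ?subr0 // => t _; rewrite scale0r.
    + move=> e f [c bc] [c' bc']; exists (fun t => c t + c' t).
      under eq_bigr => t _ do rewrite scalerDl.
      by rewrite big_split opprD addrACA; apply: bD.
    + move=> a e [c bc]; exists (fun t => a * c t).
      under eq_bigr => t _ do rewrite -scalerA.
      by rewrite -scaler_sumr -scalerBr; apply: bZ.
  - move=> b bb; exists (fun=> 0); rewrite big1 ?subr0 // => t _.
    by rewrite scale0r.
  - move=> w /(tnthP (in_tuple ws))[t ->]; exists (fun u => (u == t)%:R).
    rewrite (bigD1 t) //= eqxx scale1r big1 ?addr0 ?subrr // => u /negPf->.
    by rewrite scale0r.
have [t|t [nt bt]] := @loc_nakayama R (E i) (@bd I i) Q y _ (tnth (in_tuple ws))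
    b0 bD bZ pQ Qy.
  have : cyc (colon1 I y) (tnth (in_tuple ws) t) by rewrite yI; apply/wsc/mem_tnth.
  move=> /(les_lift iI (Vi1 _ (addgen_ideal y iI)))[s' ns' [z cz zE]].
  have [c bc] := span _ cz.
  by exists s', c; split=> //; rewrite -zE -scalerBr; apply: bZ.
move=> e ce; exists t => //; have [c bc] := span _ ce.
rewrite -[e](subrK (\sum_u c u *: tnth (in_tuple ws) u)) scalerDr.
apply: (bD); first exact: bZ.
rewrite scaler_sumr; apply: (big_ind (@bd I i)) => // u _.
by rewrite scalerA mulrC -scalerA; apply: bZ.
Qed.

(* R/X is self-injective at Q, so the powers of any y in Q become stationary,
   hence nilpotent, in the localization of R/X at Q. *)
Lemma ass_minimal P : is_prime P -> X `<=` P -> P `<=` Q -> Q `<=` P.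
Proof.
move=> pP XP PQ y Qy; apply: contrapT => nPy.
have iU : is_ideal [set v | exists t, X (v * y ^+ t)].
  split=> /=.
  - by exists 0%N; rewrite mul0r; apply: ideal_zero.
  - move=> u v [t Xu] [t' Xv]; exists (t + t')%N; rewrite mulrDl; apply: ideal_add => //.
      by rewrite exprD mulrA; apply: ideal_mulr.
    by rewrite exprD [y ^+ t * _]mulrC mulrA; apply: ideal_mulr.
  - by move=> c v [t Xv]; exists t; rewrite -mulrA; apply: ideal_mull.
have [k [g gE]] := nR iU.
have /choice[T TP] (i : 'I_k) : exists t, X (g i * y ^+ t).
  have : [set v | exists t, X (v * y ^+ t)] (g i) by rewrite gE; apply: mem_ideal_gen.
  by [].
pose t := \max_i T i.
have stab v : X (v * y ^+ t.+1) -> X (v * y ^+ t).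
  move=> Xv; suff: [set v | exists t, X (v * y ^+ t)] `<=` colon1 X (y ^+ t).
    by apply; exists t.+1.
  rewrite gE; apply: ideal_gen_min => [|i]; first exact: colon1_ideal.
  rewrite /colon1 /= -(subnKC (leq_bigmax i : T i <= t)%N) exprD mulrA.
  exact: ideal_mulr.
have [eps [[aeps deps] gen inj]] := reg_generator rxs.
(* This cocycle stands for the map y^t from R/(X : y^(t+1)) to R/X. The vanishing one degree higher
   extends it along y^(t+1), giving s' y^t = v y^(t+1) modulo X with s' outside Q. *)
have ce : cyc (colon1 X (y ^+ t.+1)) (y ^+ t *: eps).
  split; last by rewrite linearZ /= deps scaler0.
  by move=> v /stab Xv; rewrite scalerA aeps.
have V : vanish Q (addgen X (y ^+ t.+1)) (size xs).+1.
  by apply: vanish_above => //; apply: addgen_ideal.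
have [s' ns' [z /gen[v bv] zE]] := les_lift iX V ce.
have /inj : bd X ((y ^+ t * (s' - y * v)) *: eps).
  have [_ _ bZ] := bd_submod X (size xs).
  have := bZ (y ^+ t.+1) _ bv; rewrite scalerBr zE !scalerA -scalerBl.
  by congr (bd X (_ *: _)); rewrite exprS; ring.
have [iP P1 PM] := pP; have [iQ _ _] := pQ.
move=> /XP/PM[/(primeX pP)//|/PQ Qs].
by apply: ns'; rewrite -[s'](subrK (y * v)); apply: ideal_add => //; apply: ideal_mulr.
Qed.
End CohenMacaulay.
End Resolution.

(** * The square of a socle ideal *)

Section Products.
Variable R : comNzRingType.
Implicit Types I J : set R.

Lemma ideal_mulD I J x y : ideal_mul I J x -> ideal_mul I J y -> ideal_mul I J (x + y).
Proof.
move=> [k [u [v [uv ->]]]] [k' [u' [v' [uv' ->]]]]; exists (k + k')%N.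
exists (fun i => match split i with inl j => u j | inr j => u' j end).
exists (fun i => match split i with inl j => v j | inr j => v' j end).
split; first by move=> i; case: (split i) => j.
rewrite big_split_ord /=; congr (_ + _); apply: eq_bigr => i _.
  by rewrite (unsplitK (inl i : 'I_k + 'I_k')).
by rewrite (unsplitK (inr i : 'I_k + 'I_k')).
Qed.

Lemma mem_ideal_mul I J x y : I x -> J y -> ideal_mul I J (x * y).
Proof.
move=> Ix Jy; exists 1%N, (fun=> x), (fun=> y); split=> //.
by rewrite big_ord_recl big_ord0 addr0.
Qed.

Lemma ideal_mul0 I J : ideal_mul I J 0.
Proof. by exists 0%N, (fun=> 0), (fun=> 0); split; [case|rewrite big_ord0]. Qed.

Lemma ideal_mul_sum I J (T : Type) (r : seq T) (p : pred T) (F : T -> R) :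
  (forall i, p i -> ideal_mul I J (F i)) -> ideal_mul I J (\sum_(i <- r | p i) F i).
Proof.
move=> h; apply: big_ind => //; first exact: ideal_mul0.
by move=> x y; apply: ideal_mulD.
Qed.

Lemma ideal_mulS I J I' J' : I `<=` I' -> J `<=` J' -> ideal_mul I J `<=` ideal_mul I' J'.
Proof.
by move=> II JJ x [k [u [v [uv ->]]]]; exists k, u, v; split=> // i; case: (uv i) => /II ? /JJ ?.
Qed.

Lemma radical_ideal I : is_ideal I -> is_ideal (radical I).
Proof.
move=> iI; split.
- by exists 1%N; rewrite expr1; apply: ideal_zero.
- move=> x y [n xn] [k yk]; exists (n + k)%N; rewrite exprDn.
  apply: ideal_sum => // i _; rewrite -mulr_natl; apply: ideal_mull => //.
  have [ik|ki] := leqP k i.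
    by apply: ideal_mull => //; rewrite -(subnKC ik) exprD; apply: ideal_mulr.
  apply: ideal_mulr => //; rewrite -addnBA ?exprD; last exact: ltnW.
  exact: ideal_mulr.
- by move=> c x [n xn]; exists n; rewrite exprMn; apply: ideal_mull.
Qed.
End Products.

Section SocleIdeals.
Variables (A : comNzRingType) (m : set A) (d : nat) (a : 'I_d -> A) (n : 'I_d -> nat).
Hypothesis nA : noeth A.
Hypothesis pm : is_prime m.
Hypothesis um : forall x, ~ m x -> exists y, x * y = 1.
Hypothesis socle0 : forall x, (forall z, m z -> x * z = 0) -> x = 0.
Hypothesis m_nonprincipal : ~ exists2 z, m z & forall x, m x -> exists y, x = y * z.
Hypothesis am : forall k, m (a k).
Hypothesis n3 : forall k, (3 <= n k)%N.

Local Notation b := (fun j => a j ^+ n j).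

(** With the generators numbered from 0, this is the Q_k of the overview. *)
Definition tail_ideal (k : nat) : set A :=
  [set x | exists c : 'I_d -> A, x = \sum_(j < d | (k <= j)%N) c j * b j].

Local Notation Q := tail_ideal.

Hypothesis tail_colon : forall (k : 'I_d) v, Q k.+1 (v * a k * a k) -> Q k.+1 (v * a k).
Hypothesis tail_rel : forall (k : 'I_d) (c : 'I_d -> A),
  \sum_(j < d | (k < j)%N) c j * b j = 0 -> forall t : 'I_d, (k < t)%N -> Q k.+1 (a k * c t).
Hypothesis last_regular : forall k : 'I_d, k.+1 = d -> forall v, v * a k = 0 -> v = 0.

Let im : is_ideal m. Proof. by case: pm. Qed.

Lemma tail_is_ideal k : is_ideal (Q k).
Proof.
split.
- by exists (fun=> 0); rewrite big1 // => i _; rewrite mul0r.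
- move=> _ _ [c ->] [c' ->]; exists (fun i => c i + c' i).
  by rewrite -big_split; apply: eq_bigr => i _; rewrite mulrDl.
- move=> e _ [c ->]; exists (fun i => e * c i).
  by rewrite mulr_sumr; apply: eq_bigr => i _; rewrite mulrA.
Qed.

Lemma mem_tail k (j : 'I_d) : (k <= j)%N -> Q k (b j).
Proof.
move=> kj; exists (fun i => (i == j)%:R); rewrite (bigD1 j) //= eqxx mul1r.
by rewrite big1 ?addr0 // => i /andP[_ /negPf->]; rewrite mul0r.
Qed.

Lemma tail_min k J : is_ideal J -> (forall j : 'I_d, (k <= j)%N -> J (b j)) -> Q k `<=` J.
Proof. by move=> iJ h _ [c ->]; apply: ideal_sum => // i /h; apply: ideal_mull. Qed.

Lemma tail_addgen (k : 'I_d) : Q k = addgen (Q k.+1) (b k).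
Proof.
have iA := addgen_ideal (b k) (tail_is_ideal k.+1).
rewrite eqEsubset; split.
  apply: tail_min => // j; rewrite leq_eqVlt => /orP[/eqP/ord_inj <-|kj].
    by apply: mem_addgen; apply: tail_is_ideal.
  by apply: sub_addgen; apply: mem_tail.
apply: addgen_min; [exact: tail_is_ideal| |exact: mem_tail].
by apply: tail_min => [|j kj]; [exact: tail_is_ideal|apply/mem_tail/ltnW].
Qed.

Definition tail_socle k : set A := ideal_colon (Q k) m.
Local Notation J := tail_socle.

Lemma tail_socle_ideal k : is_ideal (J k).
Proof.
have iQ := tail_is_ideal k; split=> [z _|x y Jx Jy z mz|c x Jx z mz].
- by rewrite mul0r; apply: ideal_zero.
- by rewrite mulrDl; apply: ideal_add => //; [exact: Jx|exact: Jy].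
- by rewrite -mulrA; apply: ideal_mull => //; apply: Jx.
Qed.

(** * One step of the descending induction *)

Section Step.
Variable k : 'I_d.
Local Notation q := (Q k.+1).
Local Notation al := (a k).
Local Notation N := (n k).
Hypothesis qal : ~ q al.

Let U : set A := colon1 q al.
Let K : set A := [set v | forall z, m z -> addgen U al (v * z)].

Let iq : is_ideal q. Proof. exact: tail_is_ideal. Qed.
Let iU : is_ideal U. Proof. exact: colon1_ideal. Qed.

Let qU v : q v -> U v. Proof. exact: sub_colon1. Qed.

Let U_al v : U (v * al) -> U v. Proof. exact: tail_colon. Qed.

Let U_alX v e : U (v * al ^+ e) -> U v.
Proof. by elim: e => [|e IH]; [rewrite expr0 mulr1 | rewrite exprSr mulrA => /U_al]. Qed.

Let U1 : ~ U 1. Proof. by rewrite /U /colon1 /= mul1r. Qed.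

Let Um u : U u -> m u.
Proof.
move=> Uu; apply: contrapT => /um[y uy]; apply: U1.
by rewrite -uy; apply: ideal_mulr.
Qed.

Let q_al v e : U v -> (0 < e)%N -> q (al ^+ e * v).
Proof. by case: e => // e Uv _; rewrite exprSr -mulrA; apply: ideal_mull => //; rewrite mulrC. Qed.

Let alN1 : al ^+ N.-1 = al ^+ N.-2 * al.
Proof. by rewrite -exprSr; congr (_ ^+ _); move: (n3 k); lia. Qed.

Let alN : al ^+ N = al ^+ N.-2 * al * al.
Proof. by rewrite -!exprSr; congr (_ ^+ _); move: (n3 k); lia. Qed.

(* Otherwise m is principal modulo U, so that A/U is a discrete valuation
   ring; then every a_t with t > k lies in U, and the relations
   al * a_t in (a_s ^+ n_s : s > k) with n_s >= 2 put a power of al in U. *)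
Lemma coefficient_in_m z v u r : m z -> K v -> U u -> z * v = u + r * al -> m r.
Proof.
move=> mz Kv Uu zvE; apply: contrapT => /um[s rs].
have U_z x : U (z * x) -> U x.
  move=> Uzx; apply: U_al; rewrite -[x * al]mul1r -rs.
  have -> : r * s * (x * al) = s * (v * (z * x) - u * x).
    by rewrite [v * _]mulrA [v * z]mulrC zvE; ring.
  by apply: ideal_mull => //; apply: ideal_sub => //; [exact: ideal_mull|exact: ideal_mulr].
have mU w : m w -> exists c, U (w - z * c).
  move=> mw; have [c [u' [Uu' vwE]]] := Kv _ mw; exists (c * s).
  have Uv : U (v * (w - z * (c * s))).
    have -> : v * (w - z * (c * s)) = u' - c * s * u + c * al * (1 - r * s).
      have -> : v * (w - z * (c * s)) = v * w - c * s * (z * v) by ring.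
      by rewrite vwE zvE; ring.
    by rewrite rs subrr mulr0 addr0; apply: ideal_sub => //; apply: ideal_mull.
  apply: U_al; rewrite -[_ * al]mul1r -rs.
  have -> : r * s * ((w - z * (c * s)) * al) =
     s * (z * (v * (w - z * (c * s))) - u * (w - z * (c * s))).
    rewrite [z * (v * _)]mulrA zvE; ring.
  by apply: ideal_mull => //; apply: ideal_sub => //; [exact: ideal_mull|exact: ideal_mulr].
(* For the last index q = 0 and [last_regular] gives U = 0, so m itself would be principal. *)
have [kdiff|kdiff] : (k.+1 = d) \/ (k.+1 < d)%N.
  by have := ltn_ord k; rewrite leq_eqVlt => /orP[/eqP|]; [left|right].
  apply: m_nonprincipal; exists z => // x /mU[c]; rewrite /U /colon1 /= => -[e].
  rewrite big_pred0; last by move=> j; rewrite kdiff leqNgt ltn_ord.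
  by move=> /(last_regular kdiff) /eqP; rewrite subr_eq0 => /eqP ->; exists c; rewrite mulrC.
(* As z is regular modulo U, a nilpotent w = z c modulo U has c nilpotent too, so Nakayama shows
   that U is radical. *)
have radU : radical U `<=` U.
  apply: (nakayama nA pm um iU (radical_ideal iU) mz) => w [e we].
  have /mU[c Uc] : m w.
    apply: contrapT => /um[y wy]; apply: U1.
    by rewrite -(expr1n _ e) -wy exprMn; apply: ideal_mulr.
  exists c => //; have : radical U (z * c).
    rewrite -[z * c](subKr w); apply: ideal_sub; first exact: radical_ideal.
      by exists e.
    by exists 1%N; rewrite expr1.
  case=> e'; rewrite exprMn => h; exists e'; move: h.
  elim: e' (c ^+ e') => [|e' IH] x; first by rewrite mul1r.
  by rewrite exprS -mulrA => /U_z/IH.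
have aU (t : 'I_d) : (k < t)%N -> U (a t).
  by move=> kt; apply: radU; exists (n t); apply/qU/mem_tail.
have /choice[c cP] (t : 'I_d) : exists c : 'I_d -> A, (k < t)%N ->
    a t * al = \sum_(j < d | (k < j)%N) c j * b j.
  case: (ltnP k t) => [/aU[c cE]|_]; first by exists c.
  by exists (fun=> 0).
pose M : 'M[A]_d := \matrix_(t, s)
  (al *+ (t == s) - (if (k < t)%N && (k < s)%N then c t s * a s ^+ (n s).-1 else 0)).
have ld : (d.-1 < d)%N by rewrite prednK //; apply: leq_ltn_trans kdiff.
pose l : 'I_d := Ordinal ld.
have lS : l.+1 = d by rewrite /= prednK //; apply: leq_ltn_trans kdiff.
have kl : (k < l)%N by rewrite -ltnS lS.
(* M annihilates the vector of the a_s with s > k (and 0 elsewhere), whose last entry is regular.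
   Modulo U it is al times the identity, so al^d lies in U. *)
have detM : \det M = 0.
  apply: (last_regular lS).
  have := @det_trick A A^o [set 0] d M (fun s => if (k < s)%N then a s else 0) erefl _ _ _ l.
  rewrite kl; apply.
  - by move=> _ _ -> ->; rewrite /= addr0.
  - by move=> e _ ->; rewrite scaler0.
  move=> t /=; under eq_bigr => s' _ do rewrite !mxE.
  rewrite -[LHS]/(\sum_s' (_ * _)).
  under eq_bigr => s' _ do rewrite mulrBl.
  rewrite sumrB (bigD1 t) //= eqxx mulr1n big1 ?addr0; last first.
    by move=> s' st; rewrite eq_sym (negPf st) mul0r.
  have [kt|kt] := ltnP k t; last first.
    by rewrite mulr0 big1 ?subr0 // => s' _; rewrite mul0r.
  rewrite mulrC (cP _ kt) (big_mkcond (fun j : 'I_d => (k < j)%N)) -sumrB.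
  apply: big1 => s' _; case: ifP => ks; last by rewrite mul0r subrr.
  by rewrite -mulrA -exprSr prednK ?subrr //; apply: leq_trans (n3 s').
apply: U1; apply: (@U_alX _ d); rewrite mul1r.
have := @det_congr A U d M (al%:M) iU; rewrite detM det_scalar sub0r => h.
rewrite -[al ^+ d]opprK; apply: ideal_opp => //; apply: h => i j.
rewrite !mxE addrAC subrr add0r; apply: ideal_opp => //.
case: ifP => [/andP[_ kj]|_]; last exact: ideal_zero.
apply: ideal_mull => //; rewrite -(prednK (_ : 0 < (n j).-1)%N); last by move: (n3 j); lia.
by rewrite exprS; apply: ideal_mulr => //; apply: aU.
Qed.

Let Km v : K v -> m v.
Proof.
move=> Kv; apply: (coefficient_in_m (am k) Kv (ideal_zero iU)).
by rewrite add0r mulrC.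
Qed.

Let K_tail v : K v -> J k (al ^+ N.-1 * v).
Proof.
move=> Kv z mz; rewrite tail_addgen -mulrA; have [r [u [Uu ->]]] := Kv _ mz.
exists r, (al ^+ N.-1 * u); split; first by apply: q_al => //; move: (n3 k); lia.
by rewrite alN alN1; ring.
Qed.

Let J_sub : J k.+1 `<=` J k.
Proof. by move=> x Jx z mz; rewrite tail_addgen; apply: sub_addgen; apply: Jx. Qed.

Let Q_sub : q `<=` Q k.
Proof. by move=> x qx; rewrite tail_addgen; apply: sub_addgen. Qed.

Let QJ_sub x : ideal_mul q (J k.+1) x -> ideal_mul (Q k) (J k) x.
Proof. exact: ideal_mulS. Qed.

(** Take v to be the coefficient of al^N in x al, so that u = x - al^(N-1) v lies in U. Since al is
    regular modulo U, U meets q + (al) only in q; this gives u m inside q, and cancelling al^(N-1)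
    modulo U gives v in K. *)
Lemma tail_socle_decomp x : J k x -> exists x' v, [/\ J k.+1 x', K v & x = x' + al ^+ N.-1 * v].
Proof.
move=> Jx; have N3 := n3 k.
have := Jx _ (am k); rewrite tail_addgen => -[v [y [qy xE]]].
pose u := x - al ^+ N.-1 * v.
have Uu : U u.
  rewrite /U /colon1 /= /u mulrBl xE alN alN1 [X in q X](_ : _ = y) //.
  by ring.
have key z : m z -> exists s, q (u * z) /\ U (v * z - s * al).
  move=> mz; have := Jx _ mz; rewrite tail_addgen => -[s [y' [qy' xzE]]].
  exists s.
  have uzE : u * z = y' + (s * al ^+ N.-1 - al ^+ N.-2 * v * z) * al.
    by rewrite /u mulrBl xzE alN alN1; ring.
  have quz : q (u * z).
    have Uuz : U (u * z) by apply: ideal_mulr.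
    have : U (u * z - y') by apply: ideal_sub => //; apply: qU.
    rewrite {1}uzE addrAC subrr add0r => /U_al /=; rewrite /U /colon1 /= => h.
    by rewrite uzE; apply: ideal_add.
  split=> //; apply: (@U_alX _ N.-1); apply: qU.
  have -> : (v * z - s * al) * al ^+ N.-1 = y' - u * z.
    by rewrite uzE alN1; ring.
  exact: ideal_sub.
exists u, v; split; first by move=> z /key[s []].
  move=> z /key[s [_ Us]]; exists s, (v * z - s * al); split=> //.
  by rewrite subrK.
by rewrite /u subrK.
Qed.

Let q_coef x : q x -> exists c : 'I_d -> A, x = \sum_(j < d | (k < j)%N) c j * b j.
Proof. by []. Qed.

(** As v lies in m, v y = sum of V_j b_j over j > k, and it suffices that every V_j lies in K. For z
    in m write v z = u + r al; expanding u y and r y in the b_j yields a relation with coefficients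
    z V_j - p_j - al s_j, which lie in U. *)
Lemma cross_term y v : J k.+1 y -> K v ->
  ideal_mul (Q k) (J k) (al ^+ N.-1 * v * y).
Proof.
move=> Jy Kv.
have Jq z : m z -> q (z * y) by rewrite mulrC; apply: Jy.
have [V VE] := q_coef (Jq _ (Km Kv)).
have KV (t : 'I_d) : (k < t)%N -> K (V t).
  move=> kt z mz; have [r [u [Uu vzE]]] := Kv _ mz.
  have mr : m r by apply: (coefficient_in_m mz Kv Uu); rewrite mulrC.
  have [s sE] := q_coef (Jq _ mr).
  have [p pE] := q_coef (Jq _ (Um Uu)).
  have [e eE] := q_coef Uu.
  (* A second relation, from the two expansions of al u y, controls the p_j. *)
  have Up : U (p t).
    have h : \sum_(j < d | (k < j)%N) (e j * y - al * p j) * b j = 0.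
      under eq_bigr => j _ do rewrite mulrBl -mulrA [y * _]mulrC mulrA -[al * _ * _]mulrA.
      by rewrite sumrB -mulr_suml -mulr_sumr -eE -pE; ring.
    have := tail_rel h kt; rewrite mulrBr => qe.
    apply: U_al; rewrite /U /colon1 /=.
    have -> : p t * al * al = (al * y) * e t - (al * (e t * y) - al * (al * p t)) by ring.
    by apply: ideal_sub => //; apply: ideal_mulr => //; apply: Jq.
  have h : \sum_(j < d | (k < j)%N) (z * V j - p j - al * s j) * b j = 0.
    under eq_bigr => j _ do rewrite !mulrBl -!mulrA.
    rewrite !sumrB -!mulr_sumr -VE -pE -sE.
    have -> : z * (v * y) = (v * z) * y by ring.
    by rewrite vzE; ring.
  have := tail_rel h kt; rewrite mulrC => Uh.
  exists (s t), ((z * V t - p t - al * s t) + p t); split; last by ring.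
  exact: ideal_add.
rewrite -mulrA VE mulr_sumr; apply: ideal_mul_sum => j kj.
rewrite mulrA mulrC; apply: mem_ideal_mul; first by apply: mem_tail; apply: ltnW.
by apply: K_tail; apply: KV.
Qed.

(** Write v w = u + r al; then r is again in K and al^(2N-1) r = al^N (al^(N-1) r). In al^(2N-2) u
    one factor al brings u into q, and N >= 3 makes the remaining al^(2N-3) a multiple of al^N. *)
Lemma square_term v w : K v -> K w ->
  ideal_mul (Q k) (J k) (al ^+ N.-1 * v * (al ^+ N.-1 * w)).
Proof.
move=> Kv Kw; have N3 := n3 k.
have := Kw _ (Km Kv); rewrite mulrC => -[r [u [Uu vwE]]].
have Kr : K r.
  move=> z mz; have [r' [u1 [Uu1 vzE]]] := Kv _ mz.
  have mr' : m r' by apply: (coefficient_in_m mz Kv Uu1); rewrite mulrC.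
  have [s [u2 [Uu2 wrE]]] := Kw _ mr'.
  exists s, (r * z - s * al); split; last by rewrite subrK.
  apply: U_al.
  have -> : (r * z - s * al) * al = u1 * w + al * u2 - u * z.
    have -> : u = v * w - r * al by rewrite vwE; ring.
    have -> : u1 = v * z - r' * al by rewrite vzE; ring.
    have -> : u2 = w * r' - s * al by rewrite wrE; ring.
    by ring.
  by apply: ideal_sub; [|apply: ideal_add => //; [exact: ideal_mulr|exact: ideal_mull]|exact: ideal_mulr].
have -> : al ^+ N.-1 * v * (al ^+ N.-1 * w) =
    u * al * al ^+ (N.-1 + N.-2) + al ^+ N * (al ^+ N.-1 * r).
  have -> : al ^+ N.-1 * v * (al ^+ N.-1 * w) = al ^+ N.-1 * al ^+ N.-1 * (v * w) by ring.
  by rewrite vwE exprD alN alN1; ring.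
apply: ideal_mulD; last first.
  by apply: mem_ideal_mul; [exact: mem_tail | exact: K_tail].
have [c ->] := q_coef Uu; rewrite mulr_suml; apply: ideal_mul_sum => j kj.
rewrite -mulrA mulrCA; apply: mem_ideal_mul; first by apply: mem_tail; apply: ltnW.
have -> : (N.-1 + N.-2)%N = (N + (N - 3))%N by lia.
apply: (ideal_mull _ (tail_socle_ideal k)).
move=> z _; rewrite exprD -mulrA; apply: ideal_mulr; first exact: tail_is_ideal.
exact: mem_tail.
Qed.

Lemma tail_socle_step : (forall x y, J k.+1 x -> J k.+1 y -> ideal_mul q (J k.+1) (x * y)) ->
  forall x y, J k x -> J k y -> ideal_mul (Q k) (J k) (x * y).
Proof.
move=> IH x y /tail_socle_decomp[x' [v [Jx' Kv ->]]] /tail_socle_decomp[y' [w [Jy' Kw ->]]].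
rewrite mulrDl !mulrDr; apply: ideal_mulD; apply: ideal_mulD.
- by apply: QJ_sub; apply: IH.
- by rewrite mulrC; apply: cross_term.
- exact: cross_term.
- exact: square_term.
Qed.
End Step.

Lemma tail_socle_square k : (k <= d)%N -> forall x y, tail_socle k x -> tail_socle k y ->
  ideal_mul (tail_ideal k) (tail_socle k) (x * y).
Proof.
move=> kdiff; rewrite -(subKn kdiff); elim: (d - k)%N (leq_subr k d) => [|e IH] ed x y.
  rewrite subn0 => Jx Jy; suff -> : x = 0 by rewrite mul0r; apply: ideal_mul0.
  apply: socle0 => z /Jx [c ->]; apply: big_pred0 => j.
  by rewrite leqNgt ltn_ord.
have ke : (d - e.+1 < d)%N by lia.
pose k' := Ordinal ke.
have k'S : (d - e)%N = k'.+1 by rewrite /=; lia.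
rewrite k'S in IH; change (d - e.+1)%N with (k' : nat).
have IH' := IH (ltnW ed).
(* The step requires U to be proper; if it is not, b_k already lies in the smaller tail ideal and
   nothing changes. *)
have [qa|] := pselect (Q k'.+1 (a k')); last first.
  by move=> nqa; apply: tail_socle_step.
have QE : Q k' = Q k'.+1.
  rewrite tail_addgen eqEsubset; split; last exact: sub_addgen.
  apply: addgen_min => //; first exact: tail_is_ideal.
  rewrite -(prednK (_ : 0 < n k')%N) ?exprS; first by apply: ideal_mulr => //; apply: tail_is_ideal.
  by move: (n3 k'); lia.
by rewrite /tail_socle QE; apply: IH'.
Qed.
End SocleIdeals.

(** * Construction of the parameters *)

Section CohenMacaulayLocal.
Variables (R : comNzRingType) (m : set R).
Hypothesis nR : noeth R.
Hypothesis pm : is_prime m.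
Hypothesis um : forall x, ~ m x -> exists y, x * y = 1.
Implicit Types (I J P Q X : set R) (xs ys zs : seq R).

Let im : is_ideal m. Proof. by case: pm. Qed.

Definition associated I Q := is_prime Q /\ exists s, Q = colon1 I s.

Definition gens xs := addgens [set 0] xs.

Lemma gens_ideal xs : is_ideal (gens xs).
Proof. by apply: addgens_ideal; apply: zero_ideal. Qed.

Lemma gens_eqmem xs ys : xs =i ys -> gens xs = gens ys.
Proof. by apply: addgens_eqmem; apply: zero_ideal. Qed.

Lemma mem_gens xs x : x \in xs -> gens xs x.
Proof. by apply: mem_addgens; apply: zero_ideal. Qed.

Lemma gens_min xs J : is_ideal J -> (forall x, x \in xs -> J x) -> gens xs `<=` J.
Proof. by move=> iJ h; apply: addgens_min => // _ ->; apply: ideal_zero. Qed.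

Lemma prime_sub_m Q : is_prime Q -> Q `<=` m.
Proof.
move=> [iQ Q1 _] x Qx; apply: contrapT => /um[y xy]; apply: Q1.
by rewrite -xy; apply: ideal_mulr.
Qed.

Lemma associated_list I : is_ideal I ->
  exists L : seq (set R), forall Q, Q \in L <-> associated I Q.
Proof.
move=> iI; have [L [r [fL LP]]] := filt_exists nR iI.
exists [seq Q <- L | `[< associated I Q >]] => Q; rewrite mem_filter.
split; first by case/andP=> /asboolP.
move=> aQ; apply/andP; split; first exact/asboolP.
case: aQ => pQ [s QE]; rewrite QE in pQ *.
by apply: (ass_in_filt _ fL) => // P /LP[].
Qed.

Lemma regular_avoids I x : is_ideal I -> (forall Q, associated I Q -> ~ Q x) ->
  forall v, I (v * x) -> I v.
Proof.
move=> iI h v Ivx; apply: contrapT => /(ass_exists nR iI)[w pw].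
apply: (h _ (conj pw (ex_intro _ _ erefl))); rewrite /colon1 /= mulrA [x * v]mulrC.
exact: ideal_mulr.
Qed.

Lemma regular_not_associated I x Q : is_ideal I -> (forall v, I (v * x) -> I v) ->
  Q x -> ~ associated I Q.
Proof.
move=> iI h Qx [[_ Q1 _] [s QE]]; apply: Q1; rewrite QE /colon1 /= mul1r.
by apply: h; rewrite mulrC; move: Qx; rewrite QE.
Qed.

(** Listing the primes to avoid, instead of giving one regular element, allows a common choice for
    two ideals. *)
Lemma exists_regular I : is_ideal I -> ~ associated I m ->
  exists L : seq (set R), (forall Q, Q \in L -> is_prime Q /\ ~ m `<=` Q) /\
  forall x, (forall Q, Q \in L -> ~ Q x) -> forall v, I (v * x) -> I v.
Proof.
move=> iI nm; have [L LP] := associated_list iI; exists L; split.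
  move=> Q /LP aQ; split; first by case: aQ.
  move=> mQ; apply: nm; suff -> : m = Q by [].
  by rewrite eqEsubset; split=> //; apply: prime_sub_m; case: aQ.
by move=> x h; apply: regular_avoids => // Q /LP/h.
Qed.

(** Both socles are Ext^1(R/m, R/I). Explicitly, if s represents a socle element modulo I + (x),
    then w s = c x modulo I and c represents one modulo I + (w). *)
Lemma exchange I x w : is_ideal I -> m x -> m w ->
  (forall v, I (v * x) -> I v) -> (forall v, I (v * w) -> I v) ->
  associated (addgen I x) m -> associated (addgen I w) m.
Proof.
move=> iI mx mw hx hw [_ [s mE]]; split=> //.
have iIw := addgen_ideal w iI.
have nm1 : ~ m 1 by case: pm.
have [c [i [Ii wsE]]] : addgen I x (w * s) by rewrite -[addgen _ _ _]/(colon1 _ s w) -mE.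
exists c; rewrite eqEsubset; split=> v.
  move=> mv; have [e [i' [Ii' vsE]]] : addgen I x (v * s).
    by rewrite -[addgen _ _ _]/(colon1 _ s v) -mE.
  exists e, (v * c - w * e); split; last by rewrite mulrC; ring.
  apply: hx; have -> : (v * c - w * e) * x = w * i' - v * i.
    have -> : i' = v * s - e * x by rewrite vsE addrK.
    have -> : i = w * s - c * x by rewrite wsE addrK.
    by ring.
  by apply: ideal_sub => //; apply: ideal_mull.
move=> vc; apply: contrapT => /um[y vy]; apply: nm1; rewrite mE /colon1 /= mul1r.
have [f [i'' [Ii'' cE]]] : addgen I w c.
  by rewrite -[c]mul1r -vy [v * y]mulrC -mulrA; apply: ideal_mull.
exists f, (s - f * x); split; last by rewrite subrK.
apply: hw; have -> : (s - f * x) * w = i + i'' * x.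
  have -> : i = w * s - c * x by rewrite wsE addrK.
  by rewrite cE; ring.
by apply: ideal_add => //; apply: ideal_mulr.
Qed.

Definition in_m xs := forall x, x \in xs -> m x.

Lemma in_m_cons x xs : m x -> in_m xs -> in_m (x :: xs).
Proof. by move=> mx mxs y; rewrite inE => /orP[/eqP->|/mxs]. Qed.

Lemma in_m_cat xs ys : in_m (xs ++ ys) <-> in_m xs /\ in_m ys.
Proof.
split=> [h|[hx hy] x]; last by rewrite mem_cat => /orP[/hx|/hy].
by split=> x xin; apply: h; rewrite mem_cat xin ?orbT.
Qed.

Lemma in_mS x xs : in_m (x :: xs) -> m x /\ in_m xs.
Proof. by move=> h; split=> [|y ys]; apply: h; rewrite inE ?eqxx ?ys ?orbT. Qed.

Lemma reg_move x xs zs : in_m (x :: xs ++ zs) ->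
  reg [set 0] (x :: xs ++ zs) <-> reg [set 0] (xs ++ x :: zs).
Proof.
move=> h; have pE : perm_eq (x :: xs ++ zs) (xs ++ x :: zs).
  by rewrite -(cat1s x (xs ++ zs)) -(cat1s x zs) perm_catCA.
split; apply: (reg_perm nR pm um) => //; first exact: zero_ideal.
- exact: zero_ideal.
- by move=> y; rewrite -(perm_mem pE) => /h.
- by rewrite perm_sym.
Qed.

Lemma gens_move x xs zs : gens (x :: xs ++ zs) = gens (xs ++ x :: zs).
Proof. by apply: gens_eqmem => y; rewrite !(inE, mem_cat) orbCA. Qed.

(* Two maximal regular sequences have the same length: exchange their last
   elements for a common one and move it to the front. *)
Lemma depth_unique zs xs ys : in_m zs -> in_m xs -> in_m ys ->
  reg [set 0] (xs ++ zs) -> reg [set 0] (ys ++ zs) -> (size xs < size ys)%N ->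
  ~ associated (gens (xs ++ zs)) m.
Proof.
elim: xs ys zs => [|x xs IH] [|y ys] zs // mzs mxs mys rx ry sxy am.
  have : reg [set 0] (y :: zs).
    elim: (ys) y mys {sxy} ry => // y' ys' IHy y mys ry.
    have [my mys'] := in_mS mys; have [my' mys''] := in_mS mys'.
    have : reg [set 0] (y' :: y :: ys' ++ zs).
      apply: (reg_swap nR pm um) => //; first exact: zero_ideal.
    move=> [ry' _]; apply: IHy => //.
    exact: in_m_cons.
  move=> [_ hy]; apply: (regular_not_associated _ hy) am; first exact: gens_ideal.
  by case: (in_mS mys).
have [mx mxs'] := in_mS mxs; have [my mys'] := in_mS mys.
have [rx' hx] := rx; have [ry' hy] := ry.
have n1 : ~ associated (gens (xs ++ zs)) m.
  by apply: regular_not_associated hx mx; apply: gens_ideal.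
have n2 : ~ associated (gens (ys ++ zs)) m.
  by apply: regular_not_associated hy my; apply: gens_ideal.
have [L1 [L1P h1]] := exists_regular (gens_ideal _) n1.
have [L2 [L2P h2]] := exists_regular (gens_ideal _) n2.
have [|w [mw wL]] := @prime_avoidance R m (L1 ++ L2) im.
  by move=> P; rewrite mem_cat => /orP[/L1P|/L2P].
have {}h1 : forall v, gens (xs ++ zs) (v * w) -> gens (xs ++ zs) v.
  by apply: h1 => Q QL; apply: wL; rewrite mem_cat QL.
have {}h2 : forall v, gens (ys ++ zs) (v * w) -> gens (ys ++ zs) v.
  by apply: h2 => Q QL; apply: wL; rewrite mem_cat QL orbT.
have mwx : in_m (w :: xs ++ zs) by apply: in_m_cons => //; apply/in_m_cat.
have mwy : in_m (w :: ys ++ zs) by apply: in_m_cons => //; apply/in_m_cat.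
apply: (IH ys (w :: zs)) => //.
- exact: in_m_cons.
- by apply/(reg_move mwx).
- by apply/(reg_move mwy).
- rewrite -gens_move; apply: (exchange _ mx mw hx h1 am).
  exact: gens_ideal.
Qed.

(** W/X is the part of R/X killed by P. If W were inside X + (x), regularity of x would give W
    inside X + x W, hence inside X, although s is in W. So some t in W survives modulo x, and P and
    x annihilate it. *)
Lemma associated_step X P x : is_ideal X -> associated X P -> m x ->
  (forall v, X (v * x) -> X v) ->
  exists P', [/\ associated (addgen X x) P', P `<=` P' & P' x].
Proof.
move=> iX [pP [s PE]] mx hx.
pose W : set R := [set v | forall p, P p -> X (p * v)].
have iW : is_ideal W.
  split=> [p _|u v Wu Wv p Pp|c v Wv p Pp]; first by rewrite mulr0; apply: ideal_zero.
    by rewrite mulrDr; apply: ideal_add => //; [exact: Wu|exact: Wv].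
  by rewrite mulrCA; apply: ideal_mull => //; apply: Wv.
have Ws : W s by move=> p; rewrite PE.
have nXs : ~ X s by move=> Xs; case: pP => _ + _; apply; rewrite PE /colon1 /= mul1r.
have /nonsubset[t [Wt nt]] : ~ W `<=` addgen X x.
  move=> WX; apply: nXs; apply: (nakayama nR pm um iX iW mx) Ws => w Ww.
  have [c [y [Xy wE]]] := WX _ Ww; exists c.
    move=> p Pp; apply: hx; have -> : p * c * x = p * w - p * y by rewrite wE; ring.
    by apply: ideal_sub => //; [exact: Ww | exact: ideal_mull].
  by rewrite wE [x * c]mulrC addrK.
have iXx := addgen_ideal x iX.
have [w pw] := ass_exists nR iXx nt.
exists (colon1 (addgen X x) (t * w)); split.
- by split=> //; exists (t * w).
- move=> p Pp; rewrite /colon1 /= mulrA; apply: ideal_mulr => //; apply: sub_addgen.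
  exact: Wt.
- by apply: ideal_mulr => //; apply: mem_addgen.
Qed.

Lemma associated_chain zs ys P : in_m ys -> reg [set 0] (ys ++ zs) ->
  associated (gens zs) P -> exists p : nat -> set R,
  [/\ p 0%N = P, forall i, (i <= size ys)%N -> is_prime (p i),
      forall i, (i < size ys)%N -> p i `<` p i.+1 & associated (gens (ys ++ zs)) (p (size ys))].
Proof.
move=> mys + aP; elim: ys mys => [|y ys IH] mys.
  by move=> _; exists (fun=> P); split=> // i _; case: aP.
move=> [ry hy]; have [my mys'] := in_mS mys.
have [p [p0 pP pS ap]] := IH mys' ry.
have [P' [aP' PP' P'y]] := associated_step (gens_ideal _) ap my hy.
exists (fun i => if (i <= size ys)%N then p i else P'); split=> //=.
- by move=> i; rewrite leq_eqVlt ltnS => /orP[/eqP->|ii]; [rewrite ltnn; case: aP'|rewrite ii; apply: pP].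
- move=> i; rewrite ltnS => ii; rewrite ii.
  case: ltnP => [|si]; first exact: pS.
  have -> : i = size ys by apply/eqP; rewrite eqn_leq ii si.
  split=> // P'P; apply: (regular_not_associated _ hy _ ap); first exact: gens_ideal.
  exact: P'P.
- by rewrite ltnn.
Qed.

Lemma maximal_regular J : is_ideal J -> ~ J 1 ->
  exists zs P, [/\ reg [set 0] zs, forall z, z \in zs -> J z,
     associated (gens zs) P & J `<=` P].
Proof.
move=> iJ J1.
suff : forall X, is_ideal X -> forall zs, X = gens zs -> reg [set 0] zs ->
    (forall z, z \in zs -> J z) -> exists zs P, [/\ reg [set 0] zs,
     forall z, z \in zs -> J z, associated (gens zs) P & J `<=` P].
  by move=> h; have := h _ (@zero_ideal R) [::] erefl; apply.
apply: (noeth_ind nR) => X iX IH zs XE rz zJ.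
have [L LP] := associated_list iX.
have [[P [PL JP]]|h] := pselect (exists P, P \in L /\ J `<=` P).
  by exists zs, P; split=> //; rewrite -XE; apply/LP.
have [|x [Jx xL]] := prime_avoidance iJ (L := L).
  move=> P PL; split; first by case/LP: PL.
  by move=> JP; apply: h; exists P.
have hx : forall v, X (v * x) -> X v by apply: regular_avoids => // Q /LP/xL.
have XJ : X `<=` J by rewrite XE; apply: gens_min.
apply: (IH (addgen X x) (addgen_ideal x iX) _ (x :: zs)).
- split; first exact: sub_addgen.
  move=> /(_ _ (mem_addgen x iX)) Xx; apply: J1; apply: XJ; apply: hx.
  by rewrite mul1r.
- by rewrite XE.
- by split=> //; rewrite -[addgens _ _]/(gens zs) -XE.
- by move=> z; rewrite inE => /orP[/eqP->|/zJ].
Qed.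

Hypothesis unmixed : forall xs Q P, reg [set 0] xs -> associated (gens xs) Q ->
  is_prime P -> gens xs `<=` P -> P `<=` Q -> Q `<=` P.

(** An associated prime of the current sequence that contains p (k+1) contains p k, so [unmixed]
    puts it inside p k; hence prime avoidance finds a regular element in p (k+1). *)
Lemma regular_in_chain zs (p : nat -> set R) k : in_m zs -> reg [set 0] zs ->
  (forall i, (i <= k)%N -> is_prime (p i) /\ gens zs `<=` p i) ->
  (forall i, (i < k)%N -> p i `<` p i.+1) ->
  exists xs, [/\ size xs = k, in_m xs & reg [set 0] (xs ++ zs)].
Proof.
move=> mz rz pP pS.
suff [xs [sx xp rx]] : exists xs, [/\ size xs = k, forall x, x \in xs -> p k x &
    reg [set 0] (xs ++ zs)].
  by exists xs; split=> // x /xp; apply: prime_sub_m; case: (pP k).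
elim: k pP pS => [|k IH] pP pS; first by exists [::].
have [||xs [sx xp rx]] := IH.
- by move=> i ik; apply: pP; apply: leqW.
- by move=> i ik; apply: pS; apply: leqW.
have [pk1 _] := pP k.+1 (leqnn _); have [pk zk] := pP k (leqnSn _).
have [kk1 nkk1] := pS k (ltnSn _).
have ik : is_ideal (p k) by case: pk.
have Xk : gens (xs ++ zs) `<=` p k.
  apply: gens_min => // x; rewrite mem_cat => /orP[/xp//|xz].
  by apply: zk; apply: mem_gens.
have iX := gens_ideal (xs ++ zs).
have [L LP] := associated_list iX.
have [||x [px xL]] := @prime_avoidance R (p k.+1) L.
- by case: pk1.
- move=> Q /LP aQ; split; first by case: aQ.
  move=> p1Q; apply: nkk1; apply: (subset_trans p1Q).
  by apply: (unmixed rx aQ) => //; exact: (subset_trans kk1 p1Q).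
exists (x :: xs); split; first by rewrite /= sx.
  by move=> y; rewrite inE => /orP[/eqP->//|/xp]; apply: kk1.
by split=> //; apply: (regular_avoids iX) => Q /LP/xL.
Qed.

(** The closure condition of [kill_family] for all indices at once. The bound l <= i makes the
    elements from index i on regular modulo the first l and zs. *)
Definition family_spec zs xs (PP : set R -> Prop) r0 := forall P, PP P ->
  [/\ is_prime P, gens zs `<=` P & forall i, (i < size xs)%N -> P (nth 0 xs i) \/
    exists l s r, [/\ (l <= i)%N, P = colon1 (gens (take l xs ++ zs)) s, (r <= r0)%N &
      filt PP r (addgen (gens (take l xs ++ zs)) s)]].

Lemma associated_filtrations X (L : seq (set R)) : is_ideal X ->
  (forall Q, Q \in L -> associated X Q) ->
  exists (F : seq (set R)) r0, (forall P, P \in F -> is_prime P /\ X `<=` P) /\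
  forall Q, Q \in L -> exists s r, [/\ Q = colon1 X s, (r <= r0)%N &
    filt (fun P => P \in F) r (addgen X s)].
Proof.
move=> iX; elim: L => [|Q L IH] LP; first by exists [::], 0%N.
have [|F [r0 [FP FL]]] := IH; first by move=> P PL; apply: LP; rewrite inE PL orbT.
have [_ [s QE]] := LP Q (mem_head _ _).
have [F' [r [fF' F'P]]] := filt_exists nR (addgen_ideal s iX).
exists (F ++ F'), (maxn r0 r); split.
  move=> P; rewrite mem_cat => /orP[/FP//|/F'P[pP h]]; split=> //.
  by apply: subset_trans h; apply: sub_addgen.
move=> P; rewrite inE => /orP[/eqP->|/FL[s' [r' [PE rr fF]]]].
  exists s, r; split=> //; first exact: leq_maxr.
  by apply: filt_mono fF' => P' P'F; rewrite mem_cat P'F orbT.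
exists s', r'; split=> //; first by apply: leq_trans rr (leq_maxl _ _).
by apply: filt_mono fF => P' P'F; rewrite mem_cat P'F.
Qed.

(* The next element is chosen in every prime found so far that is not
   associated to the current regular sequence, and outside those that are. *)
Lemma family_exists zs k (C : seq (set R)) : in_m zs -> reg [set 0] zs ->
  (forall xs, in_m xs -> reg [set 0] (xs ++ zs) -> (size xs < k)%N ->
     ~ associated (gens (xs ++ zs)) m) ->
  (forall P, P \in C -> is_prime P /\ gens zs `<=` P) ->
  exists xs PP r0, [/\ size xs = k, in_m xs, reg [set 0] (xs ++ zs),
    forall P, P \in C -> PP P & family_spec zs xs PP r0].
Proof.
elim: k zs C => [|k IH] zs C mz rz dep CP.
  exists [::], (fun P => P \in C), 0%N; split=> // P /CP[pP XP].
  by split.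
have iX := gens_ideal zs.
have [L LP] := associated_list iX.
have [F [r0 [FP FL]]] := associated_filtrations iX (fun Q QL => (LP Q).1 QL).
(* Including m forces the new element into m; F holds the filtration factors required for the primes
   of L. No member of C' lies inside a member of L, because [unmixed] would make them equal. *)
pose C' := [seq P <- m :: C ++ F | P \notin L].
have C'P P : P \in C' -> [/\ is_prime P, gens zs `<=` P & P \notin L].
  rewrite mem_filter inE mem_cat => /andP[PL Pin].
  suff [pP XP] : is_prime P /\ gens zs `<=` P by [].
  case/orP: Pin => [/eqP->|/orP[/CP|/FP]//].
  by split=> //; apply: gens_min.
have mC' : m \in C'.
  rewrite mem_filter mem_head andbT; apply/negP => /LP am.
  by apply: (dep [::]).
pose I : set R := [set x | forall P, P \in C' -> P x].
have iI : is_ideal I.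
  split=> [P /C'P[[iP _ _] _ _]|x y Ix Iy P PC|c x Ix P PC]; first exact: ideal_zero.
    by have [[iP _ _] _ _] := C'P _ PC; apply: ideal_add => //; [exact: Ix|exact: Iy].
  by have [[iP _ _] _ _] := C'P _ PC; apply: ideal_mull => //; apply: Ix.
have [|a [Ia aL]] := prime_avoidance iI (L := L).
  move=> Q QL; have aQ := (LP Q).1 QL; have [pQ _] := aQ; split=> // IQ.
  have [|x [nQx xC]] := @avoid_in R C' Q pQ.
    move=> P /C'P[pP XP PL]; split; first by case: pP.
    move=> PQ; have QP := unmixed rz aQ pP XP PQ.
    by move/negP: PL; apply; have -> : P = Q by rewrite eqEsubset.
  by apply: nQx; apply: IQ.
have ha : forall v, gens zs (v * a) -> gens zs v.
  by apply: (regular_avoids iX) => Q /LP/aL.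
have ma : m a by apply: Ia.
have raz : reg [set 0] (a :: zs) by split.
have [|||xs [PP [r1 [sxs mxs rxs CPP PPP]]]] := IH (a :: zs) C' _ raz.
- exact: in_m_cons.
- move=> ys mys rys sys.
  have := dep (ys ++ [:: a]); rewrite -catA /= size_cat addn1 ltnS; apply=> //.
  by apply/in_m_cat; split=> // y; rewrite inE => /eqP->.
- move=> P PC; have [pP XP _] := C'P _ PC; split=> //.
  by apply: addgen_min => //; [case: pP | apply: Ia].
exists (a :: xs), (fun P => PP P \/ P \in L), (maxn r0 r1); split.
- by rewrite /= sxs.
- exact: in_m_cons.
- by apply/reg_move => //; apply: in_m_cons => //; apply/in_m_cat.
- move=> P PC; case: (boolP (P \in L)) => PL; [by right|left; apply: CPP].
  by rewrite mem_filter PL inE mem_cat PC orbT.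
move=> P [/PPP[pP XP h]|PL]; last first.
  have aP := (LP P).1 PL; have [pP [s PE]] := aP.
  split=> //; first by rewrite PE; apply: sub_colon1.
  have [s' [r [PE' rr fF]]] := FL P PL.
  move=> i _; right; exists 0%N, s', r; split=> //.
    by apply: leq_trans rr (leq_maxl _ _).
  apply: filt_mono fF => P' P'F; case: (boolP (P' \in L)) => P'L; [by right|left].
  by apply: CPP; rewrite mem_filter P'L inE mem_cat P'F !orbT.
have iP : is_ideal P by case: pP.
split=> //; first by apply: subset_trans XP; apply: sub_addgen.
case=> [|i] /= ik; first by left; apply: XP; apply: mem_addgen.
have [Px|[l [s [r [li PE rr fP]]]]] := h i ik; first by left.
right; exists l.+1, s, r; rewrite -[take _ _ ++ _]/(a :: take l xs ++ zs) gens_move; split=> //.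
  by apply: leq_trans rr (leq_maxr _ _).
by apply: filt_mono fP => P'; left.
Qed.

Section Killing.
Variables (J : set R) (zs xs : seq R) (PP : set R -> Prop) (r0 r : nat).
Hypothesis iJ : is_ideal J.
Hypotheses (mz : in_m zs) (mxs : in_m xs) (rxs : reg [set 0] (xs ++ zs)).
Hypothesis PPP : family_spec zs xs PP r0.
Hypothesis fJ : filt PP r J.
Local Notation d := (size xs).

Lemma family_kill : exists M, (0 < M)%N /\
  forall i (T : seq nat) (e : nat -> nat), (i < d)%N -> uniq T ->
  (forall j, j \in T -> (i <= j < d)%N) -> (forall j, (0 < e j)%N) ->
  kill [seq nth 0 xs j ^+ e j | j <- T] J 1 (nth 0 xs i ^+ M).
Proof.
(* The exponent obtained depends on T only through its size, which is at most d, and not on e. The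
   sum dominates all these cases. *)
pose g k := (kexp r0 k * r)%N.
exists (\sum_(k < d.+1) g k).+1; split=> // i T e id uT Td e0.
set bs := [seq _ | _ <- _].
have sT : (size T < d.+1)%N.
  rewrite ltnS -[X in (_ <= X)%N](size_iota 0); apply: uniq_leq_size => // j /Td.
  by rewrite mem_iota /= add0n => /andP[].
have regl l : (l <= i)%N -> reg (gens (take l xs ++ zs)) bs.
  move=> li.
  have rl : reg (gens (take l xs ++ zs)) (drop l xs).
    have : reg [set 0] (drop l xs ++ (take l xs ++ zs)).
      apply: (reg_perm nR pm um _ _ _ rxs); first exact: zero_ideal.
        by apply/in_m_cat.
      by rewrite -[X in perm_eq (X ++ _)](cat_take_drop l xs) -catA perm_catCA.
    by move=> /reg_cat[].
  rewrite -(mkseq_nth 0 (drop l xs)) in rl.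
  have dE : drop l xs = [seq nth 0 xs j | j <- iota l (d - l)].
    apply: (@eq_from_nth _ 0); first by rewrite size_drop size_map size_iota.
    move=> j; rewrite size_drop => jl.
    by rewrite nth_drop (nth_map 0%N) ?size_iota // nth_iota.
  rewrite mkseq_nth dE in rl.
  apply: (reg_fam nR pm um _ _ (iota_uniq l (d - l))) rl => //; first exact: gens_ideal.
    move=> j; rewrite mem_iota subnKC; last by apply: leq_trans li (ltnW id).
    by move=> /andP[_ jd]; split=> //; apply: mxs; apply: mem_nth.
  move=> j /Td /andP[ij jd]; rewrite mem_iota subnKC ?(leq_trans li ij) //.
  by apply: leq_trans li (ltnW id).
have PPk P : PP P -> kill bs P 1 (nth 0 xs i ^+ kexp r0 (size T)).
  move=> PP_P; apply: (@kill_family R PP) => //; last by rewrite size_map.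
  move=> P' /PPP[[iP' _ _] _ h]; split=> //.
  have [|[l [s [r' [li PE rr fP]]]]] := h i id; [by left|right].
  exists (gens (take l xs ++ zs)), s, r'; split=> //; first exact: gens_ideal.
  by move=> j; apply: reg_kill; [exact: gens_ideal | exact: regl].
have := kill_filt PPk iJ fJ; rewrite -exprM -/(g (size T)).
have gle : (g (size T) <= \sum_(k < d.+1) g k)%N.
  by rewrite (bigD1 (Ordinal sT)) //= leq_addr.
by rewrite -(subnK (leqW gle)) exprD; apply: kill_mulr.
Qed.
End Killing.
End CohenMacaulayLocal.

(** * Bundled ideals, units and primes *)

Section Bundling.
Variable R : comNzRingType.

Lemma idealr_is_ideal (J : idealr R) : is_ideal [set` J] /\ ~ [set` J] 1.
Proof.
split; last by rewrite /= idealr1.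
split=> /= [|x y xJ yJ|c x xJ]; [exact: idealr0|exact: rpredD|exact: idealMr].
Qed.

Lemma prime_idealr_is_prime (P : prime_idealr R) : is_prime [set` P].
Proof.
have [iP P1] := idealr_is_ideal P; split=> // x y /=.
by rewrite prime_idealrM => /orP.
Qed.

Lemma is_ideal_idealr (I : set R) : is_ideal I -> ~ I 1 -> exists J : idealr R, [set` J] = I.
Proof.
move=> iI I1; pose p : R -> bool := fun x => `[< I x >].
have cp : idealr_closed p.
  split; [by apply/asboolP; exact: ideal_zero|exact/asboolPn|].
  move=> a x y /asboolP Ix /asboolP Iy; apply/asboolP.
  exact: (ideal_add iI (ideal_mull a iI Ix) Iy).
pose J : idealr R := HB.pack p (isIdealr.Build R p cp).
exists J; rewrite eqEsubset; split=> x; first by move=> /asboolP.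
by move=> Ix; apply/asboolP.
Qed.

Lemma is_prime_prime_idealr (P : set R) : is_prime P -> exists J : prime_idealr R, [set` J] = P.
Proof.
move=> [iI I1 PM]; pose p : R -> bool := fun x => `[< P x >].
have cp : idealr_closed p.
  split; [by apply/asboolP; exact: ideal_zero|exact/asboolPn|].
  move=> a x y /asboolP Ix /asboolP Iy; apply/asboolP.
  exact: (ideal_add iI (ideal_mull a iI Ix) Iy).
have pp : prime_idealr_closed p.
  by move=> u v /asboolP/PM[?|?]; apply/orP; [left|right]; apply/asboolP.
pose J : prime_idealr R := HB.pack p (isIdealr.Build R p cp) (isPrimeIdealrClosed.Build R p pp).
exists J; rewrite eqEsubset; split=> x; first by move=> /asboolP.
by move=> Ix; apply/asboolP.
Qed.

Lemma noetherian_noeth : noetherian R -> noeth R.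
Proof.
move=> nR I iI; have [I1|nI1] := pselect (I 1).
  exists 1%N, (fun=> 1); rewrite eqEsubset; split=> x; last first.
    by move=> [c ->]; apply: ideal_sum => // i _; apply: ideal_mull.
  by move=> _; exists (fun=> x); rewrite big_ord_recl big_ord0 mulr1 addr0.
by have [J <-] := is_ideal_idealr iI nI1; apply: nR.
Qed.

(** Noetherian induction embeds a proper ideal containing x in a maximal one, which must be m. *)
Lemma local_units (m : idealr R) : noeth R -> local_ring m ->
  forall x, ~ [set` m] x -> exists y, x * y = 1.
Proof.
move=> nR [_ uniq_m] x nmx; apply: contrapT => nux.
suff h : forall I, is_ideal I -> I x -> ~ I 1 -> False.
  apply: (h (addgen [set 0] x)).
  - exact/addgen_ideal/zero_ideal.
  - exact/mem_addgen/zero_ideal.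
  - by move=> [c [_ [-> /esym]]]; rewrite add0r mulrC => xc; apply: nux; exists c.
apply: (noeth_ind nR) => I iI IH Ix I1.
have [M ME] := is_ideal_idealr iI I1.
have MI y : (y \in M) <-> I y by rewrite -ME.
have maxM : maximal_ideal M.
  move=> J MJ; have [iJ J1] := idealr_is_ideal J.
  have [JM|nJM] := pselect ([set` J] `<=` I).
    by move=> y; apply/idP/idP => [yJ|/MJ//]; apply/MI; apply: JM.
  exfalso; apply: (IH [set` J] iJ _ _ J1); last by apply: MJ; apply/MI.
  by split=> // y /MI/MJ.
by apply: nmx; rewrite /= -(uniq_m _ maxM); apply/MI.
Qed.

Lemma local_prime (m : idealr R) : (forall x, ~ [set` m] x -> exists y, x * y = 1) ->
  is_prime [set` m].
Proof.
move=> um; have [im m1] := idealr_is_ideal m; split=> // x y mxy.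
apply: contrapT => /not_orP[/um[x' xx'] /um[y' yy']]; apply: m1.
rewrite -[1]mulr1 -{1}xx' -yy'.
have -> : x * x' * (y * y') = x' * y' * (x * y) by ring.
exact: ideal_mull.
Qed.

(** If u v lies in I and powers of x lie in both I + (u) and I + (v), the product of these powers
    lies in I; so one of the two enlargements still avoids all powers of x. *)
Lemma avoid_powers (I : set R) x : noeth R -> is_ideal I -> ~ radical I x ->
  exists P, [/\ is_prime P, I `<=` P & ~ P x].
Proof.
move=> nR; move: I; apply: (noeth_ind nR) => I iI IH nx.
have [pI|npI] := pselect (is_prime I).
  by exists I; split=> // Ix; apply: nx; exists 1%N; rewrite expr1.
have [u [v [Iuv nu nv]]] : exists u v, [/\ I (u * v), ~ I u & ~ I v].
  apply: contrapT => h; apply: npI; split=> //.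
    by move=> I1; apply: nx; exists 0%N; rewrite expr0.
  move=> u v Iuv; apply: contrapT => /not_orP[nu nv].
  by apply: h; exists u, v.
have sub w : ~ I w -> ~ radical (addgen I w) x -> exists P, [/\ is_prime P, I `<=` P & ~ P x].
  move=> nw hx; have [||P [pP IP Px]] := IH (addgen I w) _ _ hx.
  - exact: addgen_ideal.
  - split; first exact: sub_addgen.
    by move=> /(_ _ (mem_addgen w iI)).
  by exists P; split=> //; apply: subset_trans IP; apply: sub_addgen.
have [[e xe]|] := pselect (radical (addgen I u) x); last exact: sub.
apply: (sub v nv) => -[e' xe']; apply: nx; exists (e + e')%N.
rewrite exprD; have [c [y [Iy ->]]] := xe; have [c' [y' [Iy' ->]]] := xe'.
have -> : (y + c * u) * (y' + c' * v) = y * (y' + c' * v) + c * u * y' + c * c' * (u * v).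
  by ring.
apply: ideal_add => //; last exact: ideal_mull.
by apply: ideal_add => //; [exact: ideal_mulr|exact: ideal_mull].
Qed.
End Bundling.

(** * Ideals along the surjection from S to A *)

Section Quotients.
Variables (S A : comNzRingType) (f : {rmorphism S -> A}) (g : A -> S).
Hypothesis fg : cancel g f.
Local Notation J := [set x | f x = 0].

Lemma ker_ideal : is_ideal J.
Proof.
split=> /= [|x y fx fy|c x fx]; first exact: rmorph0.
  by rewrite rmorphD fx fy addr0.
by rewrite rmorphM fx mulr0.
Qed.

Lemma preim_ideal (I : set A) : is_ideal I -> is_ideal [set x | I (f x)].
Proof.
move=> iI; split=> /= [|x y Ix Iy|c x Ix]; first by rewrite rmorph0; apply: ideal_zero.
  by rewrite rmorphD; apply: ideal_add.
by rewrite rmorphM; apply: ideal_mull.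
Qed.

Lemma preim_prime (P : set A) : is_prime P -> is_prime [set x | P (f x)].
Proof.
move=> [iP P1 PM]; split; first exact: preim_ideal.
  by rewrite /= rmorph1.
by move=> x y /=; rewrite rmorphM; apply: PM.
Qed.

Lemma preim_ker (I : set A) : is_ideal I -> J `<=` [set x | I (f x)].
Proof. by move=> iI x /= ->; apply: ideal_zero. Qed.

Lemma mem_image_ker (P : set S) x : is_ideal P -> J `<=` P -> [set f y | y in P] (f x) -> P x.
Proof.
move=> iP JP [y Py fyx]; rewrite -[x](subrK y); apply: ideal_add => //.
by apply: JP; rewrite /= rmorphB fyx subrr.
Qed.

Lemma image_prime (P : set S) : is_prime P -> J `<=` P -> is_prime [set f y | y in P].
Proof.
move=> [iP P1 PM] JP; split.
- split; first by exists 0; [exact: ideal_zero|rewrite rmorph0].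
    by move=> _ _ [x Px <-] [y Py <-]; exists (x + y); [exact: ideal_add|rewrite rmorphD].
  move=> c _ [x Px <-]; exists (g c * x); first exact: ideal_mull.
  by rewrite rmorphM fg.
- by rewrite -(rmorph1 f) => /mem_image_ker => /(_ iP JP).
- move=> x y; rewrite -(fg x) -(fg y) -rmorphM => /mem_image_ker => /(_ iP JP).
  by move=> /PM[h|h]; [left; exists (g x)|right; exists (g y)].
Qed.
End Quotients.

Lemma field_krull_dim (R : comNzRingType) (m : prime_idealr R) d :
  (forall x, ~ [set` m] x -> exists y, x * y = 1) -> (0 < d)%N ->
  ~ krull_dim {ideal_quot m} d.
Proof.
move=> um d0 [[p pc] _].
have := pc (inord 0) (inord 1); rewrite !inordK // => /(_ isT) [_].
move=> /nonsubset[z [/= p1z p0z]].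
have [mz|nmz] := boolP (repr z \in m).
  have z0 : z = 0.
    by rewrite -[z]reprK; apply/eqP; rewrite piE Quotient.equivE subr0.
  by apply: p0z; rewrite z0; apply: idealr0.
have [|y zy] := um (repr z); first exact/negP.
have zy1 : z * \pi_({ideal_quot m})%qT y = 1.
  by rewrite -[z]reprK !piE zy.
have : z * \pi_({ideal_quot m})%qT y \in p (inord 1) by rewrite mulrC; apply: idealMr.
by rewrite zy1 idealr1.
Qed.

(** * Krull dimension and chains of primes *)

Section Dimension.
Variable (A : comNzRingType).

Lemma chain_mono (p : nat -> set A) k i j : (forall i, (i < k)%N -> p i `<` p i.+1) ->
  (i <= j <= k)%N -> p i `<=` p j.
Proof.
move=> h /andP[ij jk]; elim: j ij jk => [|j IH]; first by rewrite leqn0 => /eqP-> _.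
rewrite leq_eqVlt => /orP[/eqP->|] => [_ //|]; rewrite ltnS => ij jk.
by apply: (subset_trans (IH ij (ltnW jk))); case: (h j jk).
Qed.

Lemma krull_chain d : krull_dim A d -> exists p : nat -> set A,
  (forall i, (i <= d)%N -> is_prime (p i)) /\ forall i, (i < d)%N -> p i `<` p i.+1.
Proof.
move=> [[p pc] _]; exists (fun i => [set` p (inord i)]); split=> i id.
  exact: prime_idealr_is_prime.
by apply: pc; rewrite !inordK //; lia.
Qed.

Lemma krull_bound d k (p : nat -> set A) : krull_dim A d ->
  (forall i, (i <= k)%N -> is_prime (p i)) -> (forall i, (i < k)%N -> p i `<` p i.+1) ->
  (k <= d)%N.
Proof.
move=> [_ dmax] pP pS.
have /choice[q qE] (i : 'I_k.+1) : exists q : prime_idealr A, [set` q] = p i.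
  by apply: is_prime_prime_idealr; apply: pP; rewrite -ltnS.
apply: (dmax k q) => i j ij; rewrite !qE.
have ik : (i < k)%N by apply: leq_trans ij _; rewrite -ltnS.
have [h1 h2] := pS i ik.
have h3 : p i.+1 `<=` p j by apply: (chain_mono pS); rewrite ij -ltnS ltn_ord.
split; first exact: subset_trans h3.
by move=> h; apply: h2; apply: subset_trans h.
Qed.

(** For p 0 < p 1 < p 2 and m = (z), z lies outside p 1, so p 1 = z p 1 and Nakayama puts p 1 inside
    p 0. *)
Lemma krull_nonprincipal (m : set A) d : noeth A -> is_prime m ->
  (forall x, ~ m x -> exists y, x * y = 1) -> krull_dim A d -> (2 <= d)%N ->
  ~ exists2 z, m z & forall x, m x -> exists y, x = y * z.
Proof.
move=> nA pm um dA d2 [z mz zP].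
have [p [pP pS]] := krull_chain dA.
have [s01 n01] := pS 0%N (ltnW d2); have [s12 n12] := pS 1%N d2.
have [i1 _ p1M] := pP 1%N (ltnW d2).
have i0 : is_ideal (p 0%N) by case: (pP 0%N).
have p2m : p 2 `<=` m by apply: (prime_sub_m um); apply: pP.
have n1z : ~ p 1%N z by move=> p1z; apply: n12 => x /p2m/zP[y ->]; exact: ideal_mull.
apply: n01; apply: (nakayama nA pm um i0 i1 mz) => w p1w.
have [y wE] := zP _ (p2m _ (s12 _ p1w)); exists y.
  by move: p1w; rewrite wE => /p1M[].
by rewrite wE mulrC subrr; apply: ideal_zero.
Qed.
End Dimension.

(** * Existence of the parameters *)

Section Existence.
Variables (S A : comNzRingType) (f : {rmorphism S -> A}) (g : A -> S).
Hypothesis fg : cancel g f.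
Variables (M : set S) (d : nat).
Hypothesis nS : noeth S.
Hypothesis pM : is_prime M.
Hypothesis uM : forall x, ~ M x -> exists y, x * y = 1.
Hypothesis unmixed : forall xs (Q P : set S), reg [set 0] xs -> associated (gens xs) Q ->
  is_prime P -> gens xs `<=` P -> P `<=` Q -> Q `<=` P.
Hypothesis dA : krull_dim A d.
Local Notation J := [set x | f x = 0].

Lemma parameters_exist : exists (xs : seq S) k, [/\ size xs = d, (0 < k)%N, in_m M xs,
  forall P, is_prime P -> J `<=` P -> (forall x, x \in xs -> P x) -> P = M &
  forall i (T : seq nat) (e : nat -> nat), (i < d)%N -> uniq T ->
  (forall j, j \in T -> (i <= j < d)%N) -> (forall j, (0 < e j)%N) ->
  kill [seq nth 0 xs j ^+ e j | j <- T] J 1 (nth 0 xs i ^+ k)].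
Proof.
have iJ := ker_ideal f.
have nJ1 : ~ J 1 by rewrite /= rmorph1 => /eqP; rewrite oner_eq0.
have JM : J `<=` M.
  move=> x Jx; apply: contrapT => /uM[y xy]; apply: nJ1.
  by rewrite -xy; apply: ideal_mulr.
have [zs [P0 [rz zJ aP0 JP0]]] := maximal_regular nS iJ nJ1.
have mz : in_m M zs by move=> z /zJ/JM.
have spJ : gens zs `<=` J by apply: gens_min.
(* A chain of d + 1 primes of A, pulled back to S, yields d regular elements beyond zs; by
   [depth_unique], m cannot become associated sooner. *)
have [ys [sys mys rys]] : exists ys, [/\ size ys = d, in_m M ys & reg [set 0] (ys ++ zs)].
  have [p [pP pS]] := krull_chain dA.
  apply: (regular_in_chain nS uM unmixed (p := fun i => [set x | p i (f x)])) => //.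
    move=> i /pP pi; split; first exact: preim_prime.
    by apply: subset_trans spJ _; apply: preim_ker; case: pi.
  move=> i /pS[h1 /nonsubset[y [py npy]]]; split; first by move=> x; apply: h1.
  by move=> /(_ (g y)); rewrite /= fg => /(_ py).
have dep xs : in_m M xs -> reg [set 0] (xs ++ zs) -> (size xs < d)%N ->
    ~ associated (gens (xs ++ zs)) M.
  by move=> mxs rxs sd; apply: (depth_unique nS pM uM mz mxs mys) => //; rewrite sys.
have [C [r [fC CP]]] := filt_exists nS iJ.
have [|xs [PP [r0 [sxs mxs rxs CPP PPP]]]] :=
    family_exists nS pM uM unmixed (C := C) mz rz dep.
  by move=> P /CP[pP JP]; split=> //; apply: subset_trans JP.
have [k [k0 kP]] := family_kill nS pM uM iJ mz mxs rxs PPP (filt_mono CPP fC).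
(* Otherwise xs extends by one more regular element, and lifting P0 along it gives a chain with d +
   1 strict inclusions of primes above J, too long for A. *)
have aM : associated (gens (xs ++ zs)) M.
  apply: contrapT => naM.
  have iX := gens_ideal (xs ++ zs).
  have [L [LP h]] := exists_regular nS uM iX naM.
  have [|w [Mw wL]] := prime_avoidance _ LP; first by case: pM.
  have rw : reg [set 0] ((w :: xs) ++ zs) by split=> //; apply: h.
  have [p [p0 pP pS _]] := associated_chain nS pM uM (in_m_cons Mw mxs) rw aP0.
  have JP i : (i <= d.+1)%N -> J `<=` p i.
    move=> id; apply: (subset_trans JP0); rewrite -p0.
    by apply: (chain_mono pS); rewrite /= sxs.
  suff : (d.+1 <= d)%N by rewrite ltnn.
  apply: (krull_bound dA (p := fun i => [set f y | y in p i])) => i id.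
    by apply: (image_prime fg); [apply: pP; rewrite /= sxs|exact: JP].
  have [|s1 s2] := pS i; first by rewrite /= sxs.
  split; first by move=> _ [y py <-]; exists y => //; apply: s1.
  move=> h'; apply: s2 => y py; apply: (mem_image_ker (f := f)).
  - by case: (pP i) => //; rewrite /= sxs ltnW.
  - by apply: JP; apply: ltnW.
  - by apply: h'; exists y.
exists xs, k; split=> //; last by rewrite -sxs.
move=> P pP JP xP; rewrite eqEsubset; split; first exact: (prime_sub_m uM).
apply: (unmixed rxs aM pP); last exact: (prime_sub_m uM).
apply: gens_min; first by case: pP.
by move=> x; rewrite mem_cat => /orP[/xP//|/zJ/JP].
Qed.
End Existence.

(** * Transfer to the quotient *)

Lemma gorenstein_unmixed (S : comNzRingType) : noeth S ->
  (exists n, inj_dim_le (S^o : lmodType S) n) ->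
  forall xs (Q P : set S), reg [set 0] xs -> associated (gens xs) Q ->
  is_prime P -> gens xs `<=` P -> P `<=` Q -> Q `<=` P.
Proof.
move=> nS [n [E [eta [dd [injE eta_inj im_eta im_dd Etop]]]]] xs Q P rxs [pQ [s QE]].
apply: (@ass_minimal S nS E eta dd n _ eta_inj _ _ _ _ Etop xs Q s rxs pQ QE).
- by move=> i I g e iI; apply: injective_lift.
- move=> e de; have : range eta e by rewrite im_eta.
  by case=> v _ <-; exists v.
- move=> v; have : range eta (eta v) by exists v.
  by rewrite im_eta.
- move=> i e de; have : range (dd i) e by rewrite im_dd.
  by case=> v _ <-; exists v.
- move=> i e; have : range (dd i) (dd i e) by exists e.
  by rewrite im_dd.
Qed.

Section Transfer.
Variables (S A : comNzRingType) (f : {rmorphism S -> A}) (g : A -> S).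
Hypothesis fg : cancel g f.
Variables (M : set S) (m : set A) (d : nat) (xs : seq S) (k : nat).
Hypothesis nS : noeth S.
Hypothesis nA : noeth A.
Hypothesis pm : is_prime m.
Hypothesis um : forall x, ~ m x -> exists y, x * y = 1.
Hypothesis socle0 : forall x, (forall z, m z -> x * z = 0) -> x = 0.
Hypothesis m_nonprincipal : ~ exists2 z, m z & forall x, m x -> exists y, x = y * z.
Hypothesis fM : forall x, m (f x) <-> M x.
Hypothesis pM : is_prime M.
Local Notation J := [set x | f x = 0].
Hypothesis k_gt0 : (0 < k)%N.
Hypothesis mxs : in_m M xs.
Hypothesis sxs : size xs = d.
Hypothesis only_M : forall P, is_prime P -> J `<=` P -> (forall x, x \in xs -> P x) -> P = M.
Hypothesis kills : forall i (T : seq nat) (e : nat -> nat), (i < d)%N -> uniq T ->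
  (forall j, j \in T -> (i <= j < d)%N) -> (forall j, (0 < e j)%N) ->
  kill [seq nth 0 xs j ^+ e j | j <- T] J 1 (nth 0 xs i ^+ k).

Let iJ : is_ideal J := ker_ideal f.

Definition param (j : 'I_d) : A := f (nth 0 xs j) ^+ k.

Variable n : 'I_d -> nat.
Hypothesis n3 : forall j, (3 <= n j)%N.
Local Notation Q := (tail_ideal param n).

(** The default 1 outside the index range keeps all exponents positive, as [kills] demands. *)
Let e (j : nat) : nat := (k * if insub j is Some i then n i else 1)%N.

Let eE (j : 'I_d) : e j = (k * n j)%N. Proof. by rewrite /e valK. Qed.

Let e_gt0 j : (0 < e j)%N.
Proof. by rewrite muln_gt0 k_gt0 /=; case: insub => // i; move: (n3 i); lia. Qed.

Local Notation bs T := [seq nth 0 xs j ^+ e j | j <- T].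

Lemma tail_of_source (l : nat) (T : seq nat) x :
  (forall j, j \in T -> (l <= j < d)%N) -> addgens J (bs T) x -> Q l (f x).
Proof.
move=> lT; have iQ := tail_is_ideal param n l.
move: x; apply: (addgens_min (J := [set x | Q l (f x)])).
- exact: (preim_ideal f iQ).
- exact: preim_ker.
move=> _ /mapP[j /lT /andP[lj jd] ->] /=.
have -> : f (nth 0 xs j ^+ e j) = param (Ordinal jd) ^+ n (Ordinal jd).
  by rewrite rmorphXn /param -exprM -(eE (Ordinal jd)).
exact: mem_tail.
Qed.

Lemma source_of_sum (p : pred 'I_d) (c : 'I_d -> A) (T : seq nat) x :
  (forall j : 'I_d, p j -> (j : nat) \in T) ->
  f x = \sum_(j < d | p j) c j * param j ^+ n j -> addgens J (bs T) x.
Proof.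
move=> pT fx; rewrite -[x](subrK (\sum_(j < d | p j) g (c j) * nth 0 xs j ^+ e j)).
have iB := addgens_ideal (bs T) iJ; apply: ideal_add => //.
  apply: sub_addgens; rewrite /= rmorphB rmorph_sum fx; apply/eqP.
  rewrite subr_eq0; apply/eqP; apply: eq_bigr => j _.
  by rewrite rmorphM fg rmorphXn eE exprM.
apply: ideal_sum => // j /pT jT; apply: ideal_mull => //; apply: mem_addgens => //.
by apply/mapP; exists (j : nat).
Qed.

Lemma param_in_m j : m (param j).
Proof.
rewrite /param -rmorphXn; apply/fM; rewrite -(prednK k_gt0) exprS.
by apply: ideal_mulr; [case: pM|apply: mxs; apply: mem_nth; rewrite sxs].
Qed.

Lemma param_tail_colon (i : 'I_d) v :
  Q i.+1 (v * param i * param i) -> Q i.+1 (v * param i).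
Proof.
move=> [c cE]; pose T := iota i.+1 (d - i.+1).
have Tlt j : j \in T -> (i.+1 <= j < d)%N.
  by rewrite mem_iota subnKC // ltn_ord.
have iT : (i : nat) \notin T by rewrite mem_iota ltnn.
(* Exponent 2k at index i matches [param i * param i]: [kill_colon] then trades both factors for a
   single x_i^k. *)
pose e' j := if j == i :> nat then (k + k)%N else e j.
have TE : [seq nth 0 xs j ^+ e' j | j <- T] = bs T.
  apply/eq_in_map => j jT; rewrite /e'; case: eqP => // ji.
  by rewrite ji (negPf iT) in jT.
have h : kill (nth 0 xs i ^+ (k + k) :: bs T) J 1 (nth 0 xs i ^+ k).
  rewrite -TE; have <- : e' i = (k + k)%N by rewrite /e' eqxx.
  apply: (kills (T := nat_of_ord i :: T)) => //=; first by rewrite iT iota_uniq.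
    move=> j; rewrite inE => /orP[/eqP->|/Tlt/andP[ij ->]].
      by rewrite leqnn ltn_ord.
    by rewrite ltnW.
  by move=> j; rewrite /e'; case: ifP => // _; rewrite addn_gt0 k_gt0.
have fx : f (nth 0 xs i ^+ k * g v) = v * param i by rewrite rmorphM rmorphXn fg mulrC.
rewrite -fx; apply: (@tail_of_source i.+1 T) => //; apply: (kill_colon iJ h).
apply: (source_of_sum (p := fun j : 'I_d => (i < j)%N) (c := c)).
  by move=> j ij; rewrite mem_iota subnKC // ij ltn_ord.
by rewrite -cE rmorphM rmorphXn fg exprD mulrA.
Qed.

(** The relation puts c_t b_t into the ideal of the other b_j with j > i, so [kill_colon] applies
    with b_t as head. *)
Lemma param_tail_rel (i : 'I_d) (c : 'I_d -> A) :
  \sum_(j < d | (i < j)%N) c j * param j ^+ n j = 0 ->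
  forall t : 'I_d, (i < t)%N -> Q i.+1 (param i * c t).
Proof.
move=> c0 t it; pose T := [seq j <- iota i.+1 (d - i.+1) | j != t :> nat].
have Tlt j : j \in T -> (i.+1 <= j < d)%N.
  by rewrite mem_filter mem_iota subnKC ?ltn_ord // => /andP[].
have tT : (t : nat) \notin T by rewrite mem_filter eqxx.
have h : kill (bs (nat_of_ord t :: T)) J 1 (nth 0 xs i ^+ k).
  apply: kills => //=; first by rewrite tT filter_uniq // iota_uniq.
  move=> j; rewrite inE => /orP[/eqP->|/Tlt/andP[ij ->]].
    by rewrite ltnW ?ltn_ord.
  by rewrite ltnW.
have fx : f (nth 0 xs i ^+ k * g (c t)) = param i * c t by rewrite rmorphM rmorphXn fg.
rewrite -fx; apply: (@tail_of_source i.+1 T) => //; apply: (kill_colon iJ h).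
apply: (source_of_sum (p := fun j : 'I_d => (i < j)%N && (j != t)) (c := fun j => - c j)).
  by move=> j /andP[ij jt]; rewrite mem_filter mem_iota subnKC // ij ltn_ord jt.
move: c0; rewrite (bigD1 t) //= => /eqP; rewrite addr_eq0 => /eqP ctE.
rewrite rmorphM rmorphXn fg eE exprM ctE -sumrN.
by apply: eq_bigr => j _; rewrite mulNr.
Qed.

(** As i is last, every x_j^k kills the homology on x_i^k, hence v. An associated prime above the
    annihilator of v then contains all x_j, so it is M, against [socle0]. *)
Lemma param_last_regular (i : 'I_d) : i.+1 = d -> forall v, v * param i = 0 -> v = 0.
Proof.
move=> iS v v0; apply: contrapT => nv.
have nJ : ~ J (g v) by rewrite /= fg.
have [w pw] := ass_exists nS iJ nJ.
have iw : is_ideal (colon1 J (g v * w)) by case: pw.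
have PM : colon1 J (g v * w) = M.
  apply: only_M => //; first by move=> x Jx; apply: ideal_mulr.
  move=> x /(nthP 0)[j jd <-]; rewrite sxs in jd.
  apply: (primeX (n := k) pw).
  have h : kill [:: nth 0 xs i ^+ k] J 1 (nth 0 xs j ^+ k).
    apply: (kills (T := [:: nat_of_ord i]) (e := fun=> k)) => // j'.
    by rewrite inE => /eqP->; rewrite ltn_ord andbT -ltnS iS.
  rewrite /colon1 /= mulrA rmorphM (_ : f (_ * _) = 0) ?mul0r //.
  by apply: (kill_colon iJ h); rewrite /= rmorphM rmorphXn fg.
have [_ n1 _] := pw; apply: n1; rewrite /colon1 /= mul1r.
apply: socle0 => z mz; rewrite -(fg z) -rmorphM mulrC.
have : M (g z) by apply/fM; rewrite fg.
by rewrite -PM.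
Qed.

Lemma param_socle_square x y :
  ideal_colon (Q 0) m x -> ideal_colon (Q 0) m y ->
  ideal_mul (Q 0) (ideal_colon (Q 0) m) (x * y).
Proof.
apply: (tail_socle_square nA pm um socle0 m_nonprincipal param_in_m n3) => //.
- exact: param_tail_colon.
- exact: param_tail_rel.
- exact: param_last_regular.
Qed.
End Transfer.

Unset Implicit Arguments.
Set Strict Implicit.

Theorem mainTheorem1 (A : comNzRingType) (m : idealr A) (d : nat)
    (A_noetherian : noetherian A) (A_local : local_ring m)
    (A_dim : krull_dim A d) (d_ge2 : (2 <= d)%N)
    (A_image : image_of_gorenstein_local A)
    (A_unmixed : forall p : prime_idealr A,
       associated_prime p -> krull_dim {ideal_quot p} d) :
  exists a : 'I_d -> A,
    system_of_parameters m a /\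
    forall n : 'I_d -> nat, (forall i, (1 <= n i)%N) ->
      let Q := ideal_gen (fun i => a i ^+ n i) in
      let I := ideal_colon Q [set` m] in
      ideal_mul I I = ideal_mul Q I.
Proof.
have nA := noetherian_noeth A_noetherian.
have um := local_units nA A_local.
have pm := local_prime um.
have [S [f [[S_noetherian [mS S_local] S_inj] f_surj]]] := A_image.
have nS := noetherian_noeth S_noetherian.
have uM := local_units nS S_local.
have pM := local_prime uM.
have /choice[g fg] : forall y, exists x, f x = y.
  by move=> y; have [x _ <-] : range f y by [rewrite f_surj]; exists x.
have fM x : [set` m] (f x) <-> [set` mS] x.
  have [im m1 _] := pm; have [iM M1 _] := pM.
  split=> [mx|Mx]; apply: contrapT.
    move=> /uM[y xy]; apply: m1; rewrite -(rmorph1 f) -xy rmorphM; exact: ideal_mulr.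
  move=> /um[y xy]; have : f (x * g y - 1) = 0.
    by rewrite rmorphB rmorph1 rmorphM fg xy subrr.
  move=> Jx; have [Mx1|/uM[z zE]] := pselect ([set` mS] (x * g y - 1)).
    apply: M1; rewrite -[1](subKr (x * g y)); apply: ideal_sub => //; exact: ideal_mulr.
  by have := oner_neq0 A; rewrite -(rmorph1 f) -zE rmorphM Jx mul0r eqxx.
have [xs [k [sxs k0 mxs only_M kills]]] :=
  parameters_exist fg nS pM uM (gorenstein_unmixed nS S_inj) A_dim.
(* If m x = 0 with x nonzero, m is the annihilator of x, hence associated, and the field A/m would
   have dimension d > 0. *)
have socle0 x : (forall z, [set` m] z -> x * z = 0) -> x = 0.
  move=> mx; apply: contrapT => nx; have [p pE] := is_prime_prime_idealr pm.
  have pm_iff y : (y \in p) <-> [set` m] y by rewrite -pE.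
  apply: (@field_krull_dim A p d); [by rewrite pE|by apply: leq_trans d_ge2|].
  apply: A_unmixed; exists x => y; apply/idP/eqP; first by move=> /pm_iff/mx; rewrite mulrC.
  move=> yx; apply/pm_iff; apply: contrapT => /um[z yz]; apply: nx.
  by rewrite -[x]mul1r -yz mulrAC yx mul0r.
have m_np := krull_nonprincipal nA pm um A_dim d_ge2.
(* Cubing turns an exponent n_j >= 1 into 3 n_j >= 3. *)
exists (fun j => param f xs k j ^+ 3); split.
  split=> //; rewrite eqEsubset; split=> y.
    move=> [e] ye; apply: (primeX (n := e) pm); apply: ideal_gen_min ye => [|j].
      by case: pm.
    rewrite exprS; apply: ideal_mulr; first by case: pm.
    exact: (param_in_m fM pM k0 mxs sxs).
  (* A prime of S over the preimage of the parameter ideal contains J and all x_j, so it is M and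
     contains [g y]. *)
  move=> my; pose I := [set x | ideal_gen (fun j : 'I_d => param f xs k j ^+ 3) (f x)].
  have iI : is_ideal I := preim_ideal f (ideal_gen_ideal _).
  apply: contrapT => ny; have [|P [pP IP]] := @avoid_powers S I (g y) nS iI.
    by move=> [e ye]; apply: ny; exists e; move: ye; rewrite /I /= rmorphXn fg.
  apply; rewrite (only_M P pP); first by apply/fM; rewrite fg.
    by move=> x /= Jx; apply: IP; rewrite /I /= Jx; apply: ideal_zero; apply: ideal_gen_ideal.
  move=> x /(nthP 0)[j]; rewrite sxs => jd <-; apply: (primeX (n := (k * 3)%N) pP).
  apply: IP; rewrite /I /= rmorphXn exprM.
  exact: (mem_ideal_gen (fun j : 'I_d => param f xs k j ^+ 3) (Ordinal jd)).
move=> n n1 Q I.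
have QE : Q = tail_ideal (param f xs k) (fun j => (3 * n j)%N) 0.
  rewrite eqEsubset; split=> x [c ->]; exists c;
    by apply: eq_big => // j _; rewrite exprM.
have iQ : is_ideal Q by apply: ideal_gen_ideal.
have QI : Q `<=` I by move=> x Qx z _; apply: ideal_mulr.
rewrite eqEsubset; split; last exact: ideal_mulS.
move=> _ [l [u [v [uv ->]]]]; apply: ideal_mul_sum => i _.
have [Iu Iv] := uv i; move: Iu Iv; rewrite /I QE.
apply: (param_socle_square fg nS nA pm um socle0 m_np fM pM k0 mxs sxs only_M kills).
by move=> j; move: (n1 j); lia.
Qed.
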